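(* Let $p$ be an odd prime. The following is a complete list, without repetition, of the simple paramedial quasigroups of order $p^2$ up to isomorphism: every simple paramedial quasigroup of order $p^2$ is isomorphic to exactly one of the quasigroups $\mathrm{Aff}(\mathbb{Z}_p^2,+,\varphi,\psi,c)$ below, and each quasigroup below is a simple paramedial quasigroup of order $p^2$. (1) $\varphi=\begin{pmatrix} a & 0 \\ 0 & -a \end{pmatrix}$ with $a\in\mathbb{Z}_p$, $0<a<-a$, and $\psi=\begin{pmatrix} k & 1 \\ {a^2-k^2} & -k \end{pmatrix}$ with $k\in\mathbb{Z}_p$, $k\neq\pm a$, where: $c=\begin{pmatrix} 0 \\ 0 \end{pmatrix}$ if $k\neq 2^{-1}a^{-1}-a$ (this gives $\frac{p^2-4p+5}{2}$ quasigroups); and $c\in\left\{\begin{pmatrix} 0 \\ 0 \end{pmatrix},\begin{pmatrix} 0 \\ 1 \end{pmatrix}\right\}$ if $k=2^{-1}a^{-1}-a$ (this gives $p-3$ quasigroups). (2) $\varphi=\begin{pmatrix} 0 & 1 \\ {a} & b \end{pmatrix}$ with $a,b\in\mathbb{Z}_p$ such that $x^2-bx-a$ is irreducible over $\mathbb{Z}_p$, $\psi=\varphi$, $c=\begin{pmatrix} 0 \\ 0 \end{pmatrix}$ (this gives $\frac{p^2-p}{2}$ quasigroups). (3) $\varphi=\begin{pmatrix} 0 & 1 \\ {a} & b \end{pmatrix}$ with $a,b\in\mathbb{Z}_p$ such that $x^2-bx-a$ is irreducible over $\mathbb{Z}_p$, $\psi=-\varphi$, $c=\begin{pmatrix} 0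 \\ 0 \end{pmatrix}$ (this gives $\frac{p^2-p}{2}$ quasigroups). (4) $\varphi=\begin{pmatrix} 0 & 1 \\ {a} & 0 \end{pmatrix}$ with $a\in\mathbb{Z}_p$ such that $x^2-a$ is irreducible over $\mathbb{Z}_p$, and $\psi$ running over a set of representatives of those orbits, under conjugation by the centralizer of $\varphi$ in $GL(2,p)$, of matrices $$\begin{pmatrix} k & l \\ {l^{-1}(a-k^2)} & -k \end{pmatrix},\qquad k,l\in\mathbb{Z}_p,\ l\neq 0,\ (k,l)\neq(0,\pm1),$$ which do not consist of matrices satisfying $k^2-al^2+(1-2a)l-a=0$; for each such $a$ there are exactly $p-3$ such orbits; $c=\begin{pmatrix} 0 \\ 0 \end{pmatrix}$ (this gives $\frac{(p-1)(p-3)}{2}$ quasigroups). (5) $\varphi=\begin{pmatrix} 0 & 1 \\ {a} & 0 \end{pmatrix}$ with $a\in\mathbb{Z}_p$ such that $x^2-a$ is irreducible over $\mathbb{Z}_p$, and, for each such $a$, one matrix $\psi=\begin{pmatrix} k & l \\ {l^{-1}(a-k^2)} & -k \end{pmatrix}$, where $(k,l)\in\mathbb{Z}_p^2$ is an arbitrarily chosen solution of $k^2-al^2+(1-2a)l-a=0$ (any such solution has $l\neq0$), and $c\in\left\{\begin{pmatrix} 0 \\ 0 \end{pmatrix},\mathbf{w}\right\}$, where $\mathbf{w}$ is an arbitrarily chosen vector with $\mathbf{w}\notin\mathrm{Im}(1-\varphi-\psi)$ (this gives $p-1$ quasigroups).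
   Context: A quasigroup is a set $A$ with a binary operation $*$ such that for all $a,b\in A$ the equations $a*x=b$ and $y*a=b$ have unique solutions $x,y\in A$. A quasigroup $(A,* )$ is paramedial if $(x*y)*(u*v)=(v*y)*(u*x)$ for all $x,y,u,v\in A$. A quasigroup is simple if it has no proper congruences (i.e. no congruences other than the equality relation and the full relation); equivalently, every homomorphism from it is injective or trivial. Given an abelian group $(G,+)$, automorphisms $\varphi,\psi$ of $G$ and $c\in G$, $\mathrm{Aff}(G,+,\varphi,\psi,c)$ denotes the quasigroup on the set $G$ with operation $x*y=\varphi(x)+\psi(y)+c$. Elements of $\mathbb{Z}_p^2$ are written as column vectors, and automorphisms of $\mathbb{Z}_p^2$ are identified with matrices in $GL(2,p)$ acting on column vectors from the left; $1$ in $1-\varphi-\psi$ denotes the identity. The notation $0<a<-a$ refers to the usual order on the representatives $\{0,1,\dots,p-1\}$ of $\mathbb{Z}_p$, i.e. it means $a\in\{1,\dots,\frac{p-1}{2}\}$ modulo $p$. *)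

(* Defs.v *)
From mathcomp Require Import all_boot all_order all_algebra.
From mathcomp Require Import qpoly.

Set Implicit Arguments.
Unset Strict Implicit.
Unset Printing Implicit Defensive.

Import GRing.Theory.
Local Open Scope ring_scope.

Definition quasigroup (A : Type) (op : A -> A -> A) : Prop :=
  forall a b : A, (exists! x, op a x = b) /\ (exists! y, op y a = b).

Definition paramedial (A : Type) (op : A -> A -> A) : Prop :=
  forall x y u v : A, op (op x y) (op u v) = op (op v y) (op u x).

(* On a finite quasigroup, compatibility with the multiplication implies
   compatibility with both divisions. *)
Definition congruence (A : finType) (op : A -> A -> A) (e : rel A) : Prop :=
  equivalence_rel e /\
  forall x x' y y' : A, e x x' -> e y y' -> e (op x y) (op x' y').

Definition simple_quasigroup (A : finType) (op : A -> A -> A) : Prop :=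
  forall e : rel A, congruence op e ->
    (forall x y, e x y = (x == y)) \/ (forall x y, e x y).

Definition simple_paramedial_quasigroup_of_order
    (n : nat) (A : finType) (op : A -> A -> A) : Prop :=
  [/\ quasigroup op, paramedial op, simple_quasigroup op & #|A| = n].

Definition qg_isomorphic (A B : Type)
    (opA : A -> A -> A) (opB : B -> B -> B) : Prop :=
  exists2 f : A -> B,
    bijective f & forall x y, f (opA x y) = opB (f x) (f y).

Definition Aff (G : zmodType) (phi psi : G -> G) (c : G) : G -> G -> G :=
  fun x y => phi x + psi y + c.

(* A triple (phi, psi, c); matrices act on column vectors from the left. *)
Definition aff_data (F : nzRingType) : Type :=
  ('M[F]_2 * 'M[F]_2 * 'cV[F]_2)%type.

Definition Aff_mx (F : nzRingType) (t : aff_data F) :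
    'cV[F]_2 -> 'cV[F]_2 -> 'cV[F]_2 :=
  let: (phi, psi, c) := t in Aff (mulmx phi) (mulmx psi) c.

(* The matrix with rows (a, b) and (c, d). *)
Definition mx22 (F : nzRingType) (a b c d : F) : 'M[F]_2 :=
  \matrix_(i < 2, j < 2)
    if i == 0 then (if j == 0 then a else b) else (if j == 0 then c else d).

Definition col2 (F : nzRingType) (x y : F) : 'cV[F]_2 :=
  \col_(i < 2) if i == 0 then x else y.

Definition mx_Im (F : finNzRingType) (M : 'M[F]_2) : {set 'cV[F]_2} :=
  [set M *m v | v : 'cV[F]_2].

Definition GL_centralizer (F : finFieldType) (phi : 'M[F]_2) : {set 'M[F]_2} :=
  [set g in unitmx | g *m phi == phi *m g].

Definition conj_orbit (F : finFieldType) (phi psi : 'M[F]_2) : {set 'M[F]_2} :=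
  [set g *m psi *m invmx g | g in GL_centralizer phi].

(* The order is that of the representatives 0, ..., p-1, through the coercion
   of 'F_p to nat. *)
Definition fam1_params (p : nat) (a k : 'F_p) : bool :=
  [&& (0 < a)%N, (a < (- a)%R)%N, k != a & k != - a].

Definition fam1_phi (F : nzRingType) (a : F) : 'M[F]_2 := mx22 a 0 0 (- a).

Definition fam1_psi (F : nzRingType) (a k : F) : 'M[F]_2 :=
  mx22 k 1 (a ^+ 2 - k ^+ 2) (- k).

Definition fam1_generic (p : nat) : {set aff_data 'F_p} :=
  [set (fam1_phi a, fam1_psi a k, col2 0 0)
     | a in {: 'F_p}, k in {: 'F_p}
     & fam1_params a k && (k != 2^-1 * a^-1 - a)].

Definition fam1_special (p : nat) : {set aff_data 'F_p} :=
  [set (fam1_phi ak.1, fam1_psi ak.1 ak.2, c)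
     | ak in [set ak : 'F_p * 'F_p | fam1_params ak.1 ak.2
                & ak.2 == 2^-1 * ak.1^-1 - ak.1],
       c in [set col2 0 0; col2 0 1]].

(* irreducibleb is the boolean form of irreducible_poly over a finite ring
   (see irreducibleP). *)
Definition irr_quad (F : finFieldType) (a b : F) : bool :=
  irreducibleb ('X^2 - b *: 'X - a%:P : {poly F}).

Definition comp_mx (F : nzRingType) (a b : F) : 'M[F]_2 := mx22 0 1 a b.

Definition fam2 (F : finFieldType) : {set aff_data F} :=
  [set (comp_mx a b, comp_mx a b, col2 0 0) | a in {: F}, b in {: F} & irr_quad a b].

Definition fam3 (F : finFieldType) : {set aff_data F} :=
  [set (comp_mx a b, - comp_mx a b, col2 0 0) | a in {: F}, b in {: F} & irr_quad a b].

Definition irr_sq (F : finFieldType) (a : F) : bool :=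
  irreducibleb ('X^2 - a%:P : {poly F}).

Definition psi_kl (F : fieldType) (a k l : F) : 'M[F]_2 :=
  mx22 k l (l^-1 * (a - k ^+ 2)) (- k).

Definition conic (F : nzRingType) (a k l : F) : bool :=
  k ^+ 2 - a * l ^+ 2 + (1 - 2 * a) * l - a == 0.

Definition fam4_psis (F : finFieldType) (a : F) : {set 'M[F]_2} :=
  [set psi_kl a k l | k in {: F}, l in {: F}
     & [&& l != 0, (k, l) != (0, 1) & (k, l) != (0, -1)]].

(* For M = psi_kl a k l, the entries M 0 0 and M 0 1 are k and l. *)
Definition fam4_orbits (F : finFieldType) (a : F) : {set {set 'M[F]_2}} :=
  [set O in [set conj_orbit (comp_mx a 0) psi | psi in fam4_psis a]
     | ~~ (O \subset [set M : 'M[F]_2 | conic a (M 0 0) (M 0 1)])].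

Definition orbit_representatives (T : finType)
    (P : {set {set T}}) (X : {set T}) : Prop :=
  X \subset cover P /\ forall O, O \in P -> #|X :&: O| = 1%N.

Definition fam4 (F : finFieldType) (reps : F -> {set 'M[F]_2}) :
    {set aff_data F} :=
  [set (comp_mx a 0, psi, col2 0 0) | a in [pred a : F | irr_sq a],
     psi in reps a].

Definition fam5 (F : finFieldType) (kl : F -> F * F) (w : F -> 'cV[F]_2) :
    {set aff_data F} :=
  [set (comp_mx a 0, psi_kl a (kl a).1 (kl a).2, c)
     | a in [pred a : F | irr_sq a], c in [set col2 0 0; w a]].

(* The arbitrary choices: for each a with x^2 - a irreducible, the orbit
   representatives psi, a solution (k, l) of the equation and a vector w. *)
Definition valid_choices (F : finFieldType) (reps : F -> {set 'M[F]_2})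
    (kl : F -> F * F) (w : F -> 'cV[F]_2) : Prop :=
  forall a : F, irr_sq a ->
    [/\ orbit_representatives (fam4_orbits a) (reps a),
        conic a (kl a).1 (kl a).2 &
        w a \notin mx_Im (1%:M - comp_mx a 0 - psi_kl a (kl a).1 (kl a).2)].

(* The index keeps apart the entries of different families, so that equal
   triples in two families would count as a repetition. *)
Definition families (p : nat) (reps : 'F_p -> {set 'M['F_p]_2})
    (kl : 'F_p -> 'F_p * 'F_p) (w : 'F_p -> 'cV['F_p]_2) :
    6.-tuple {set aff_data 'F_p} :=
  [tuple fam1_generic p; fam1_special p; fam2 'F_p; fam3 'F_p;
         fam4 reps; fam5 kl w].

(* Main.v *)
From HB Require Import structures.
Require Import Defs.
From mathcomp Require Import all_boot all_order all_algebra.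
From mathcomp Require Import fingroup pgroup abelian mxabelem.
From mathcomp Require Import zify ring.
Set Implicit Arguments.
Unset Strict Implicit.
Unset Printing Implicit Defensive.
Import GRing.Theory.
Local Open Scope ring_scope.

(** Every paramedial quasigroup is affine over an abelian group
    ([paramedial_affine], a variant of Toyoda's theorem on medial quasigroups).
    When it is finite and simple the group has prime exponent, since the
    relation x^p = y^p is a congruence; for order p^2 the quasigroup is
    therefore x * y = phi x + psi y + c on F_p^2 for two matrices phi and psi
    ([simple_paramedial_coordinates]). Paramediality then says exactly that
    phi^2 = psi^2, and simplicity that phi and psi have no common invariant
    line. This condition is used in two forms. A common left eigenvector r
    gives the congruence r x = r y, so simplicity excludes common left
    eigenvectors ([simple_Aff_mx_no_common_row]); a congruence is given by a
    subgroup stable under phi and psi, so excluding common right eigenvectors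
    gives simplicity ([no_common_col_Aff_mx_simple]).

    Two such quasigroups are isomorphic exactly when the pairs (phi, psi) are
    simultaneously conjugate and the constants c are both inside or both outside
    the image of 1 - phi - psi ([Aff_mx_isomorphic_intertwines] and
    [intertwines_Aff_mx_isomorphic]): translations move c inside a coset of that
    image, and when the image is a line, rescaling identifies all the cosets that
    do not contain 0.

    It remains to classify the pairs up to conjugation. If phi and psi commute,
    (phi - psi)(phi + psi) = 0 forces psi = phi or psi = - phi, with phi
    irreducible. Otherwise Cayley-Hamilton makes both traces vanish and both
    squares equal to one scalar a ([same_square_cases]). The pair is then
    determined by a and by t = tr(phi psi) = phi psi + psi phi: a left eigenvector
    of phi when a is a square ([intertwines_fam1]), and a left vector r with
    r psi = k r + l r phi when it is not ([intertwines_psi_kl]), yields, with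
    its image under psi or phi, a basis in which the pair has the required shape. In the second
    case such an r exists precisely when (k, l) lies on the conic
    k^2 - a l^2 + t l - a = 0, so the orbits of psi under the centralizer of phi
    are the level sets of t ([conj_orbit_level]). All values of t occur, because
    the conic always has a point ([exists_conic_point]); t = 2 a and t = - 2 a are
    the cases psi = phi and psi = - phi, and t = 1 - 2 a is the case where
    1 - phi - psi is singular. *)

(** * Two-by-two matrices *)

Lemma mx22_eta (F : nzRingType) (M : 'M[F]_2) :
  M = mx22 (M 0 0) (M 0 1) (M 1 0) (M 1 1).
Proof.
apply/matrixP=> i j; rewrite !mxE.
by case: i => [[|[|//]] hi]; case: j => [[|[|//]] hj]; congr (M _ _); apply: val_inj.
Qed.

Lemma mx22_inj (F : nzRingType) (a b c d a' b' c' d' : F) :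
  mx22 a b c d = mx22 a' b' c' d' -> [/\ a = a', b = b', c = c' & d = d'].
Proof.
by move/matrixP=> e; split; [have := e 0 0|have := e 0 1|have := e 1 0|have := e 1 1];
  rewrite !mxE.
Qed.

Lemma mul_mx22 (F : nzRingType) (a b c d a' b' c' d' : F) :
  mx22 a b c d *m mx22 a' b' c' d' =
  mx22 (a * a' + b * c') (a * b' + b * d') (c * a' + d * c') (c * b' + d * d').
Proof.
apply/matrixP=> i j; rewrite !mxE big_ord_recl big_ord1 !mxE /=.
by case: i => [[|[|//]] hi]; case: j => [[|[|//]] hj].
Qed.

Lemma add_mx22 (F : nzRingType) (a b c d a' b' c' d' : F) :
  mx22 a b c d + mx22 a' b' c' d' = mx22 (a + a') (b + b') (c + c') (d + d').
Proof. by apply/matrixP=> i j; rewrite !mxE; do 2!case: ifP. Qed.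

Lemma opp_mx22 (F : nzRingType) (a b c d : F) :
  - mx22 a b c d = mx22 (- a) (- b) (- c) (- d).
Proof. by apply/matrixP=> i j; rewrite !mxE; do 2!case: ifP. Qed.

Lemma scale_mx22 (F : nzRingType) (x a b c d : F) :
  x *: mx22 a b c d = mx22 (x * a) (x * b) (x * c) (x * d).
Proof. by apply/matrixP=> i j; rewrite !mxE; do 2!case: ifP. Qed.

Lemma scalar_mx22 (F : nzRingType) (x : F) : x%:M = mx22 x 0 0 x :> 'M[F]_2.
Proof.
by apply/matrixP=> i j; rewrite !mxE; case: i => [[|[|//]] hi];
   case: j => [[|[|//]] hj].
Qed.

Lemma trace_mx22 (F : nzRingType) (a b c d : F) : \tr (mx22 a b c d) = a + d.
Proof. by rewrite /mxtrace big_ord_recl big_ord1 !mxE. Qed.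

Lemma det_mx22 (F : comNzRingType) (a b c d : F) :
  \det (mx22 a b c d) = a * d - b * c.
Proof.
rewrite (expand_det_row _ 0) big_ord_recl big_ord1 /cofactor !det_mx11 !mxE /=.
by rewrite expr0 expr1 mul1r mulN1r mulrN.
Qed.

Definition mx22E :=
  (scalar_mx22, opp_mx22, scale_mx22, add_mx22, mul_mx22, trace_mx22, det_mx22).

Lemma Cayley_Hamilton22 (F : comNzRingType) (M : 'M[F]_2) :
  M *m M = \tr M *: M - (\det M)%:M.
Proof. by rewrite (mx22_eta M) !mx22E; congr mx22; ring. Qed.

Definition rows2 (F : nzRingType) (r s : 'rV[F]_2) : 'M[F]_2 :=
  \matrix_(i < 2) if i == 0 then r else s.

Lemma rows2_mulmx (F : nzRingType) (r s : 'rV[F]_2) (M : 'M[F]_2) :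
  rows2 r s *m M = rows2 (r *m M) (s *m M).
Proof. by apply/row_matrixP=> i; rewrite row_mul !rowK; case: ifP. Qed.

Lemma mulmx_rows2 (F : fieldType) (r s : 'rV[F]_2) (a b c d : F) :
  mx22 a b c d *m rows2 r s = rows2 (a *: r + b *: s) (c *: r + d *: s).
Proof.
apply/row_matrixP=> i; rewrite row_mul rowK mulmx_sum_row big_ord_recl big_ord1.
by rewrite !rowK !mxE /=; case: ifP.
Qed.

(** A nonzero left kernel vector of the matrix with rows r and s is a linear
    relation between them. *)
Lemma rows2_dependent (F : fieldType) (r s : 'rV[F]_2) :
  r != 0 -> rows2 r s \notin unitmx -> exists x, s = x *: r.
Proof.
move=> r_neq0; rewrite unitmxE unitfE negbK => /det0P[v v_neq0].
rewrite mulmx_sum_row big_ord_recl big_ord1 !rowK /= => dep.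
have v1_neq0 : v 0 (lift ord0 ord0) != 0.
  apply: contra v_neq0 => /eqP v1_0; move: dep; rewrite v1_0 scale0r addr0.
  move/eqP; rewrite scaler_eq0 (negPf r_neq0) orbF => /eqP v0_0.
  apply/eqP/rowP=> j; rewrite mxE.
  by case: (unliftP ord0 j) => [j' ->|-> //]; rewrite ord1.
exists (- (v 0 (lift ord0 ord0))^-1 * v 0 ord0).
apply: (scalerI v1_neq0).
rewrite scalerA mulNr mulrN mulVKf // scaleNr; apply/eqP.
by rewrite -addr_eq0 addrC dep.
Qed.

Lemma eq_mx_on_basis (F : fieldType) (r s : 'rV[F]_2) (M N : 'M[F]_2) :
  rows2 r s \in unitmx -> r *m M = r *m N -> s *m M = s *m N -> M = N.
Proof.
move=> rs_unit eqr eqs; rewrite -[M](mulKmx rs_unit) -[N](mulKmx rs_unit).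
by rewrite !rows2_mulmx eqr eqs.
Qed.

Lemma mx_Im_unit (F : finFieldType) (M : 'M[F]_2) (x : 'cV[F]_2) :
  M \in unitmx -> x \in mx_Im M.
Proof. by move=> M_unit; apply/imsetP; exists (invmx M *m x); rewrite ?mulKVmx. Qed.

(** A singular nonzero matrix of order 2 has rank one, so its image is the
    kernel of the linear form r spanning its left kernel. *)
Lemma mx_Im_singular (F : finFieldType) (M : 'M[F]_2) :
  \det M = 0 -> M != 0 ->
  exists r : 'rV[F]_2, forall x, (x \in mx_Im M) = (r *m x == 0).
Proof.
move=> /eqP/det0P[r r_neq0 rM_0] M_neq0; exists r => x; apply/imsetP/eqP.
  by case=> v _ ->; rewrite mulmxA rM_0 mul0mx.
move=> rx_0.
have [j cj_neq0] : exists j, col j M != 0.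
  apply/existsP; apply: contraR M_neq0 => /existsPn M_0.
  apply/eqP/matrixP=> i j; have /eqP/colP/(_ i) := negbNE (M_0 j).
  by rewrite !mxE.
have /rows2_dependent : (col j M)^T != 0 by rewrite trmx_eq0.
case/(_ x^T) => [|y x_eq].
  apply/negP=> u; have: rows2 (col j M)^T x^T *m r^T = 0.
    apply/row_matrixP=> i; rewrite row_mul rowK row0.
    by case: ifP => _; rewrite -trmx_mul -?colE ?rx_0 ?trmx0 // colE mulmxA rM_0 mul0mx trmx0.
  move/(canRL (mulKmx u)); rewrite mulmx0 => /eqP.
  by rewrite trmx_eq0 (negPf r_neq0).
exists (y *: delta_mx j 0) => //.
by rewrite -scalemxAr -colE -[LHS]trmxK x_eq linearZ /= trmxK.
Qed.

(** * Isomorphisms between affine quasigroups *)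

(** Over a prime field additivity implies linearity, scalars being multiples
    of 1. *)
Lemma additive_mulmx (p n : nat) (h : 'cV['F_p]_n -> 'cV['F_p]_n) :
  {morph h : x y / x + y} -> exists M, forall x, h x = M *m x.
Proof.
move=> hD; have h0 : h 0 = 0 by apply: (addrI (h 0)); rewrite -hD !addr0.
have hZ a x : h (a *: x) = a *: h x.
  rewrite -(natr_Zp a) !scaler_nat.
  by elim: (val a) => [|k IHk]; rewrite ?mulr0n ?h0 // !mulrS hD IHk.
exists (\matrix_(i, j) h (delta_mx j 0) i 0) => x.
rewrite [x in LHS]matrix_sum_delta (big_morph h hD h0); apply/colP=> i.
rewrite summxE mxE; apply: eq_bigr => j _.
by rewrite big_ord1 hZ !mxE mulrC.
Qed.

Definition intertwines (F : fieldType) (g phi psi phi' psi' : 'M[F]_2) : Prop :=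
  [/\ g \in unitmx, g *m phi = phi' *m g & g *m psi = psi' *m g].

Lemma mx_Im_intertwines (F : finFieldType) (g phi psi phi' psi' : 'M[F]_2) x :
  intertwines g phi psi phi' psi' ->
  (g *m x \in mx_Im (1%:M - phi' - psi')) = (x \in mx_Im (1%:M - phi - psi)).
Proof.
case=> g_unit g_phi g_psi.
have g1 : g *m (1%:M - phi - psi) = (1%:M - phi' - psi') *m g.
  by rewrite !mulmxBr !mulmxBl mulmx1 mul1mx g_phi g_psi.
apply/imsetP/imsetP=> [[v _ gx_eq]|[v _ ->]].
  exists (invmx g *m v) => //; apply: (can_inj (mulKmx g_unit)).
  by rewrite gx_eq mulmxA g1 -mulmxA mulKVmx.
by exists (g *m v); rewrite // !mulmxA g1.
Qed.

Lemma mx_ImD (F : finFieldType) (M : 'M[F]_2) x y :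
  y \in mx_Im M -> (x + y \in mx_Im M) = (x \in mx_Im M).
Proof.
case/imsetP=> v _ ->; apply/imsetP/imsetP=> [[u _ xE]|[u _ ->]].
  by exists (u - v); rewrite // mulmxBr -xE addrK.
by exists (u + v); rewrite // mulmxDr.
Qed.

Lemma bijective_mulmx (F : fieldType) (g : 'M[F]_2) :
  g \in unitmx -> bijective (mulmx g : 'cV[F]_2 -> 'cV[F]_2).
Proof. by move=> g_unit; exists (mulmx (invmx g)); [apply: mulKmx|apply: mulKVmx]. Qed.

(** For an isomorphism f, the map h x = f x - f 0 satisfies
    h (phi x + psi y + c) = phi' (h x) + psi' (h y) + K; since phi and psi are
    onto, z |-> h (z + c) - K is additive, and it turns out to be h itself. *)
Lemma Aff_mx_isomorphic_intertwines (p : nat) (phi psi phi' psi' : 'M['F_p]_2)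
    (c c' : 'cV['F_p]_2) :
  phi \in unitmx -> psi \in unitmx ->
  qg_isomorphic (Aff_mx (phi, psi, c)) (Aff_mx (phi', psi', c')) ->
  exists2 g, intertwines g phi psi phi' psi' &
    (c \in mx_Im (1%:M - phi - psi)) = (c' \in mx_Im (1%:M - phi' - psi')).
Proof.
move=> phi_unit psi_unit [f f_bij f_hom].
pose h x := f x - f 0.
pose K := phi' *m f 0 + psi' *m f 0 + c' - f 0.
have h_hom x y : h (phi *m x + psi *m y + c) = phi' *m h x + psi' *m h y + K.
  have /= := f_hom x y; rewrite /Aff /h /K => ->; rewrite !mulmxBr.
  set A := phi' *m f x; set B := psi' *m f y.
  set A0 := phi' *m f 0; set B0 := psi' *m f 0.
  by apply/colP=> i; rewrite !mxE; ring.
have h0 : h 0 = 0 by rewrite /h subrr.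
pose k z := h (z + c) - K.
have k_hom x y : k (phi *m x + psi *m y) = phi' *m h x + psi' *m h y.
  by rewrite /k h_hom addrK.
have k_phi x : k (phi *m x) = phi' *m h x.
  by have := k_hom x 0; rewrite h0 !mulmx0 !addr0.
have k_psi y : k (psi *m y) = psi' *m h y.
  by have := k_hom 0 y; rewrite h0 !mulmx0 !add0r.
have kD : {morph k : x y / x + y}.
  move=> x y; rewrite -[x](mulKVmx phi_unit) -[y](mulKVmx psi_unit).
  by rewrite k_hom k_phi k_psi.
have hk z : h z = k z.
  have hE u : h u = k u - k c + K.
    have : k u = k (u - c) + k c by rewrite -kD subrK.
    by rewrite {2}/k subrK => ->; rewrite addrK subrK.
  have k0 : k 0 = 0 by apply: (addrI (k 0)); rewrite -kD !addr0.
  have cK : - k c + K = 0 by have := hE 0; rewrite h0 k0 sub0r => <-.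
  by rewrite hE -addrA cK addr0.
have [g gE] := additive_mulmx kD.
have g_unit : g \in unitmx.
  rewrite -unitmx_tr unitmxE unitfE; apply/negP=> /det0P[v v_neq0 vg_0].
  have [f' fK f'K] := f_bij.
  have /(congr1 trmx) : g *m v^T = 0 by rewrite -[LHS]trmxK trmx_mul trmxK vg_0 trmx0.
  rewrite -gE -hk /h => /eqP; rewrite trmx0 trmx_eq0 subr_eq0 => /eqP.
  by move/(can_inj fK)/eqP; rewrite trmx_eq0 (negPf v_neq0).
have intertw : intertwines g phi psi phi' psi'.
  split=> //; apply/trmx_inj/row_matrixP=> i; rewrite -!tr_col; congr (_^T);
    by rewrite !colE -!mulmxA -!gE ?k_phi ?k_psi hk.
exists g => //.
have: g *m c = c' + (1%:M - phi' - psi') *m - f 0.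
  rewrite -gE -hk; have := h_hom 0 0.
  rewrite h0 !mulmx0 !add0r => ->; rewrite /K mulmxN !mulmxBl mul1mx.
  set A0 := phi' *m f 0; set B0 := psi' *m f 0.
  by apply/colP=> i; rewrite !mxE; ring.
move=> gcE; rewrite -(mx_Im_intertwines c intertw) gcE mx_ImD //.
by apply/imsetP; exists (- f 0).
Qed.

(** The isomorphism sought is x |-> y g x - v with a nonzero scalar y, and it
    exists as soon as y g c - c' lies in the image of 1 - phi' - psi'. When
    c' is outside that image, the image is the kernel of a linear form r, and
    y = r c' / r (g c) makes the value of r vanish. *)
Lemma intertwines_Aff_mx_isomorphic (F : finFieldType) (g phi psi phi' psi' : 'M[F]_2)
    (c c' : 'cV[F]_2) :
  intertwines g phi psi phi' psi' -> 1%:M - phi' - psi' != 0 ->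
  (c \in mx_Im (1%:M - phi - psi)) = (c' \in mx_Im (1%:M - phi' - psi')) ->
  qg_isomorphic (Aff_mx (phi, psi, c)) (Aff_mx (phi', psi', c')).
Proof.
move=> intertw M_neq0 c_eq; have [g_unit g_phi g_psi] := intertw.
set M := 1%:M - phi' - psi' in M_neq0 c_eq.
suff [y y_neq0] : exists2 y, y != 0 & y *: (g *m c) - c' \in mx_Im M.
  case/imsetP=> v _ vE.
  have yg_unit : y *: g \in unitmx by rewrite unitmxZ // unitfE.
  exists (fun x => y *: g *m x - v).
    have [f fK f'K] := bijective_mulmx yg_unit.
    exists (fun z => f (z + v)) => x; first by rewrite subrK fK.
    by rewrite f'K addrK.
  move=> x z; rewrite /= /Aff !mulmxDr !mulmxA -!scalemxAl g_phi g_psi !mulmxN.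
  move/eqP: vE; rewrite subr_eq => /eqP ->; rewrite /M !mulmxBl mul1mx.
  rewrite -!scalemxAr !scalemxAl -!mulmxA.
  move: (_ *m _) (_ *m _) (phi' *m v) (psi' *m v) => X Y U V.
  by apply/colP=> i; rewrite !mxE; ring.
have gcM : (g *m c \in mx_Im M) = (c' \in mx_Im M).
  by rewrite (mx_Im_intertwines _ intertw).
have [c'M|c'M] := boolP (c' \in mx_Im M).
  exists 1; rewrite ?oner_eq0 // scale1r -(mx_ImD _ c'M) subrK.
  by rewrite gcM.
have [r rE] : exists r : 'rV[F]_2, forall x, (x \in mx_Im M) = (r *m x == 0).
  apply: mx_Im_singular => //; apply/eqP; apply: contraNT c'M => detM.
  by apply: mx_Im_unit; rewrite unitmxE unitfE.
move: c'M gcM; rewrite !rE => rc'; rewrite (negPf rc') => rgc.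
have mx11_eq0 (A : 'M[F]_1) : (A == 0) = (A 0 0 == 0).
  by rewrite {1}[A]mx11_scalar -scalemx1 scaler_eq0 oner_eq0 orbF.
rewrite !mx11_eq0 in rc' rgc.
exists ((r *m c') 0 0 / (r *m (g *m c)) 0 0).
  by rewrite mulf_neq0 // invr_eq0 rgc.
rewrite rE mulmxBr -scalemxAr mx11_eq0.
move: (r *m c') (r *m (g *m c)) rc' rgc => A B _ /negbT B_neq0.
by rewrite !mxE divfK // subrr.
Qed.

(** * Normal forms of pairs of matrices with the same square *)

(** Irreducibility of the pair acting on row vectors. *)
Definition no_common_row (F : fieldType) (phi psi : 'M[F]_2) : Prop :=
  forall (r : 'rV[F]_2) x y, r *m phi = x *: r -> r *m psi = y *: r -> r = 0.

(** Polarization of the Cayley-Hamilton identity. *)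
Lemma anticommutator22 (F : comNzRingType) (M N : 'M[F]_2) :
  \tr M = 0 -> \tr N = 0 -> M *m N + N *m M = (\tr (M *m N))%:M.
Proof.
rewrite (mx22_eta M) (mx22_eta N) !mx22E.
move: (M 0 0) (N 0 0) => m n /eqP; rewrite addr_eq0 => /eqP -> /eqP.
by rewrite addr_eq0 => /eqP ->; congr mx22; ring.
Qed.

Lemma sqr_traceless22 (F : comNzRingType) (M : 'M[F]_2) :
  \tr M = 0 -> M *m M = (- \det M)%:M.
Proof. by rewrite Cayley_Hamilton22 => ->; rewrite scale0r sub0r raddfN. Qed.

Lemma det_subr_scalar22 (F : comNzRingType) (M : 'M[F]_2) x :
  \det (M - x%:M) = x ^+ 2 - \tr M * x + \det M.
Proof. by rewrite (mx22_eta M) !mx22E; ring. Qed.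

Lemma det_pencil (F : comNzRingType) (M N : 'M[F]_2) l :
  \tr M = 0 -> \tr N = 0 ->
  \det (N - l *: M) = \det N + l * \tr (M *m N) + l ^+ 2 * \det M.
Proof.
rewrite (mx22_eta M) (mx22_eta N) !mx22E.
move: (M 0 0) (N 0 0) => m n /eqP; rewrite addr_eq0 => /eqP -> /eqP.
by rewrite addr_eq0 => /eqP ->; ring.
Qed.

Lemma exists_left_eigenvector (F : fieldType) (M : 'M[F]_2) x :
  x ^+ 2 - \tr M * x + \det M = 0 -> exists2 r : 'rV_2, r != 0 & r *m M = x *: r.
Proof.
rewrite -det_subr_scalar22 => /eqP/det0P[r r_neq0 rM]; exists r => //.
by apply/eqP; rewrite -subr_eq0 -mul_mx_scalar -mulmxBr rM.
Qed.

Lemma left_eigenvalue_root (F : fieldType) (M : 'M[F]_2) x (r : 'rV[F]_2) :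
  r != 0 -> r *m M = x *: r -> x ^+ 2 - \tr M * x + \det M = 0.
Proof.
move=> r_neq0 rM; apply/eqP; rewrite -det_subr_scalar22; apply/det0P.
by exists r; rewrite // mulmxBr rM mul_mx_scalar subrr.
Qed.

(** In the basis r, r phi, right multiplication by phi is given by the
    companion matrix of its characteristic polynomial. *)
Lemma cyclic_vector_comp_mx (F : fieldType) (phi : 'M[F]_2) (r : 'rV[F]_2) :
  rows2 r (r *m phi) *m phi = comp_mx (- \det phi) (\tr phi) *m rows2 r (r *m phi).
Proof.
rewrite rows2_mulmx mulmx_rows2 scale0r scale1r add0r -mulmxA.
rewrite Cayley_Hamilton22 mulmxBr mul_mx_scalar -scalemxAr; congr rows2.
by rewrite addrC scaleNr.
Qed.

Lemma cyclic_vector_unit (F : fieldType) (phi : 'M[F]_2) (r : 'rV[F]_2) :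
  (forall x, x ^+ 2 - \tr phi * x + \det phi != 0) -> r != 0 ->
  rows2 r (r *m phi) \in unitmx.
Proof.
move=> no_root r_neq0; apply/negPn/negP=> /(rows2_dependent r_neq0)[x rphi].
by have /eqP := no_root x; rewrite (left_eigenvalue_root r_neq0 rphi).
Qed.

Lemma intertwines_comp_mx (F : fieldType) (phi : 'M[F]_2) :
  (forall x, x ^+ 2 - \tr phi * x + \det phi != 0) ->
  exists2 g, g \in unitmx & g *m phi = comp_mx (- \det phi) (\tr phi) *m g.
Proof.
move=> no_root; exists (rows2 (delta_mx 0 0) (delta_mx 0 0 *m phi)).
  apply: cyclic_vector_unit => //; apply/eqP=> /rowP/(_ 0)/eqP.
  by rewrite !mxE !eqxx oner_eq0.
exact: cyclic_vector_comp_mx.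
Qed.

(** If phi and psi commute then (phi - psi)(phi + psi) = 0, and a nonzero row
    r of phi - psi is killed by phi + psi; either r and r phi form a basis and
    psi = - phi, or r is a common eigenvector. So they do not commute. Now
    tr(phi) phi - det(phi) = tr(psi) psi - det(psi), and a nonzero trace would
    make one matrix a polynomial in the other. *)
Lemma same_square_cases (F : fieldType) (phi psi : 'M[F]_2) :
  phi *m phi = psi *m psi -> no_common_row phi psi ->
  psi != phi -> psi != - phi ->
  [/\ \tr phi = 0, \tr psi = 0 & \det phi = \det psi].
Proof.
move=> sq_eq irr psi_neq psi_neqN.
have not_comm : phi *m psi != psi *m phi.
  apply: contra psi_neqN => /eqP comm; rewrite -addr_eq0 addrC.
  have prod0 : (phi - psi) *m (phi + psi) = 0.
    by rewrite mulmxBl !mulmxDr comm sq_eq [X in X - _]addrC subrr.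
  have [i ri_neq0] : exists i, row i (phi - psi) != 0.
    apply/existsP; apply: contraR psi_neq => /existsPn rows0.
    rewrite -subr_eq0 -opprB oppr_eq0; apply/eqP/row_matrixP=> i.
    by rewrite row0; apply/eqP/negbNE.
  set r := row i _ in ri_neq0.
  have r_sum : r *m (phi + psi) = 0 by rewrite -row_mul prod0 row0.
  have r_psi : r *m psi = - (r *m phi).
    by apply/eqP; rewrite -addr_eq0 -mulmxDr addrC r_sum.
  have [u|nu] := boolP (rows2 r (r *m phi) \in unitmx).
    apply/eqP; apply: (eq_mx_on_basis u); rewrite mulmx0 //.
    by rewrite -mulmxA mulmxDr comm -mulmxDl mulmxA r_sum mul0mx.
  have [x r_phi] := rows2_dependent ri_neq0 nu.
  rewrite (irr r x (- x)) ?eqxx // in ri_neq0.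
  by rewrite r_psi r_phi scaleNr.
have CH : \tr phi *: phi - (\det phi)%:M = \tr psi *: psi - (\det psi)%:M.
  by rewrite -!Cayley_Hamilton22.
have tr0 (M N : 'M[F]_2) : M *m N != N *m M ->
    \tr M *: M - (\det M)%:M = \tr N *: N - (\det N)%:M -> \tr M = 0.
  move=> nc e; apply/eqP; apply: contraR nc => t_neq0.
  have : (\tr M *: M) *m N = N *m (\tr M *: M).
    have -> : \tr M *: M = \tr N *: N - (\det N)%:M + (\det M)%:M by rewrite -e subrK.
    by rewrite mulmxDl mulmxDr mulmxBl mulmxBr !scalar_mxC -scalemxAl -scalemxAr.
  by rewrite -scalemxAl -scalemxAr => /(scalerI t_neq0) ->.
have trphi := tr0 _ _ not_comm CH.
have trpsi : \tr psi = 0 by apply: (tr0 _ phi); rewrite ?CH // eq_sym.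
split=> //; move: CH; rewrite trphi trpsi !scale0r !sub0r => /oppr_inj/matrixP/(_ 0 0).
by rewrite !mxE.
Qed.

(** Let r be a left eigenvector of phi for s. The anticommutation relation
    shows that r psi - k r is a left eigenvector for - s when tr(phi psi) =
    2 s k; together with r it is the basis sought. The values k = s and
    k = - s would make r or r psi - k r a common eigenvector. *)
Lemma intertwines_fam1 (F : fieldType) (phi psi : 'M[F]_2) s :
  (2 : F) != 0 -> s != 0 ->
  \tr phi = 0 -> \tr psi = 0 -> \det phi = - s ^+ 2 -> \det psi = - s ^+ 2 ->
  no_common_row phi psi ->
  exists k, [/\ k != s, k != - s &
    exists g, intertwines g phi psi (fam1_phi s) (fam1_psi s k)].
Proof.
move=> two_neq0 s_neq0 trphi trpsi detphi detpsi irr.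
(* This value makes r psi - k r an eigenvector for - s. *)
pose k := \tr (phi *m psi) / (2 * s); exists k.
have [|r r_neq0 r_phi] := @exists_left_eigenvector _ phi s.
  by rewrite trphi detphi mul0r subr0 subrr.
pose q := r *m psi - k *: r.
have r_psi : r *m psi = k *: r + q by rewrite addrC subrK.
have q_phi : q *m phi = - s *: q.
  have ac : psi *m phi = (\tr (phi *m psi))%:M - phi *m psi.
    by rewrite -(anticommutator22 trphi trpsi) addrC addKr.
  rewrite /q mulmxBl -mulmxA ac mulmxBr mul_mx_scalar mulmxA r_phi -scalemxAl.
  rewrite -scalemxAl r_phi scalerA.
  have -> : \tr (phi *m psi) = 2 * s * k by rewrite /k mulrC divfK // mulf_neq0.
  by apply/rowP=> j; rewrite !mxE; ring.
have q_psi : q *m psi = (s ^+ 2 - k ^+ 2) *: r + - k *: q.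
  rewrite {1}/q mulmxBl -mulmxA sqr_traceless22 // detpsi opprK mul_mx_scalar.
  rewrite -scalemxAl r_psi.
  by apply/rowP=> j; rewrite !mxE; ring.
have g_unit : rows2 r q \in unitmx.
  apply/negPn/negP=> /(rows2_dependent r_neq0)[x qE]; move/eqP: r_neq0; apply.
  by apply: (irr _ s (k + x)); rewrite // r_psi qE scalerDl.
have k_neq : s ^+ 2 - k ^+ 2 != 0.
  apply/eqP=> sk; have q0 : q = 0.
    by apply: (irr _ (- s) (- k)); rewrite // q_psi sk scale0r add0r.
  by move/eqP: r_neq0; apply; apply: (irr _ s k); rewrite // r_psi q0 addr0.
split; try by apply: contra k_neq => /eqP ->; rewrite ?sqrrN subrr.
exists (rows2 r q); split=> //; rewrite rows2_mulmx mulmx_rows2.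
  by rewrite r_phi q_phi !scale0r addr0 add0r.
by rewrite q_psi scale1r r_psi.
Qed.

(** The conic equation is the vanishing of det(psi - l phi - k), which
    provides r with r psi = k r + l r phi. In the basis r, r phi the matrix
    phi takes companion form, and the image of r phi under psi follows from
    the anticommutation relation. *)
Lemma intertwines_psi_kl (F : fieldType) (phi psi : 'M[F]_2) a k l :
  (forall x, x ^+ 2 != a) -> l != 0 ->
  \tr phi = 0 -> \tr psi = 0 -> \det phi = - a -> \det psi = - a ->
  k ^+ 2 - a * l ^+ 2 + \tr (phi *m psi) * l - a = 0 ->
  exists g, intertwines g phi psi (comp_mx a 0) (psi_kl a k l).
Proof.
move=> a_nsq l_neq0 trphi trpsi detphi detpsi kl.
have [r r_neq0 r_psi0] : exists2 r : 'rV_2, r != 0 & r *m (psi - l *: phi - k%:M) = 0.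
  apply/det0P; rewrite det_subr_scalar22; apply/eqP.
  have -> : \tr (psi - l *: phi) = 0.
    by rewrite raddfB /= linearZ /= trphi trpsi mulr0 subr0.
  by rewrite mul0r subr0 det_pencil // detphi detpsi -[RHS]kl; ring.
have r_psi : r *m psi = k *: r + l *: (r *m phi).
  move: r_psi0; rewrite !mulmxBr mul_mx_scalar -scalemxAr => /eqP.
  by rewrite !subr_eq add0r => /eqP.
exists (rows2 r (r *m phi)); split.
- apply: cyclic_vector_unit => // x.
  by rewrite trphi detphi mul0r subr0 subr_eq0.
- by rewrite cyclic_vector_comp_mx detphi trphi opprK.
rewrite rows2_mulmx mulmx_rows2 r_psi; congr rows2.
have -> : r *m phi *m psi = \tr (phi *m psi) *: r - r *m psi *m phi.
  rewrite -!mulmxA -mul_mx_scalar -mulmxBr; congr (_ *m _).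
  by rewrite -anticommutator22 // addrK.
rewrite r_psi mulmxDl -!scalemxAl -mulmxA sqr_traceless22 // detphi opprK mul_mx_scalar.
have -> : \tr (phi *m psi) = l * a + l^-1 * (a - k ^+ 2).
  apply: (mulfI l_neq0); rewrite mulrDr mulVKf //.
  apply/eqP; rewrite -subr_eq0 -[X in _ == X]kl; apply/eqP; ring.
by apply/rowP=> j; rewrite !mxE; ring.
Qed.

(** * Simplicity and paramediality of affine quasigroups *)

Lemma qg_isomorphic_sym (A B : Type) (opA : A -> A -> A) (opB : B -> B -> B) :
  qg_isomorphic opA opB -> qg_isomorphic opB opA.
Proof.
case=> f [g fK gK] f_hom; exists g; first by exists f.
by move=> x y; rewrite -[x]gK -[y]gK -f_hom !fK.
Qed.

Lemma qg_isomorphic_trans (A B C : Type) (opA : A -> A -> A) (opB : B -> B -> B)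
    (opC : C -> C -> C) :
  qg_isomorphic opA opB -> qg_isomorphic opB opC -> qg_isomorphic opA opC.
Proof.
case=> f f_bij f_hom [g g_bij g_hom]; exists (g \o f); first exact: bij_comp.
by move=> x y /=; rewrite f_hom g_hom.
Qed.

Lemma quasigroup_isomorphic (A B : Type) (opA : A -> A -> A) (opB : B -> B -> B) :
  qg_isomorphic opA opB -> quasigroup opA -> quasigroup opB.
Proof.
case=> f [g fK gK] f_hom qA a b; have [[x [xE xU]] [y [yE yU]]] := qA (g a) (g b).
split; [exists (f x)|exists (f y)]; split.
- by rewrite -[a]gK -f_hom xE gK.
- by move=> z zE; rewrite (xU (g z)) ?gK //; apply: (can_inj fK); rewrite f_hom !gK.
- by rewrite -[a]gK -f_hom yE gK.
- by move=> z zE; rewrite (yU (g z)) ?gK //; apply: (can_inj fK); rewrite f_hom !gK.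
Qed.

Lemma paramedial_isomorphic (A B : Type) (opA : A -> A -> A) (opB : B -> B -> B) :
  qg_isomorphic opA opB -> paramedial opA -> paramedial opB.
Proof.
case=> f [g fK gK] f_hom pA x y u v.
by rewrite -[x]gK -[y]gK -[u]gK -[v]gK -!f_hom pA.
Qed.

Lemma simple_isomorphic (A B : finType) (opA : A -> A -> A) (opB : B -> B -> B) :
  qg_isomorphic opA opB -> simple_quasigroup opA -> simple_quasigroup opB.
Proof.
case=> f [g fK gK] f_hom sA e [e_eqv e_op].
have [] := sA (fun x y => e (f x) (f y)).
- split; first by move=> x y z; apply: e_eqv.
  by move=> x x' y y' ex ey; rewrite !f_hom; apply: e_op.
- by move=> eE; left=> x y; rewrite -[x]gK -[y]gK eE (can_eq fK).
by move=> eE; right=> x y; rewrite -[x]gK -[y]gK eE.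
Qed.

(** A common left eigenvector r makes r x = r y a congruence, which is neither
    equality, as r has a nonzero kernel, nor full unless r = 0. *)
Lemma simple_Aff_mx_no_common_row (F : finFieldType) (phi psi : 'M[F]_2) c :
  simple_quasigroup (Aff_mx (phi, psi, c)) -> no_common_row phi psi.
Proof.
move=> simpl r x y r_phi r_psi.
have [] := simpl (fun u v => r *m u == r *m v).
- split; first by move=> u v w; split=> // /eqP ->.
  move=> u u' v v' /eqP eu /eqP ev; rewrite /= /Aff !mulmxDr !mulmxA r_phi r_psi.
  by rewrite -!scalemxAl eu ev.
- move=> /(_ (col2 (- r 0 1) (r 0 0)) 0); rewrite mulmx0.
  have -> : r *m col2 (- r 0 1) (r 0 0) = 0.
    apply/rowP=> i; rewrite !mxE big_ord_recl big_ord1 !mxE /=.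
    have -> : lift ord0 ord0 = 1 :> 'I_2 by apply: val_inj.
    ring.
  rewrite eqxx => /esym/eqP/colP v0; have := v0 0; have := v0 1; rewrite !mxE /=.
  move=> r0 /eqP; rewrite oppr_eq0 => /eqP r1; apply/rowP=> j; rewrite mxE.
  by case: j => [[|[|//]] hj]; [rewrite -[RHS]r0|rewrite -[RHS]r1]; congr (r _ _); apply: val_inj.
move=> full; apply/rowP=> j; have := full (delta_mx j 0) 0.
by rewrite mulmx0 -colE => /eqP/colP/(_ 0); rewrite !mxE.
Qed.

Lemma quasigroup_Aff_mx_unit (F : fieldType) (phi psi : 'M[F]_2) c :
  quasigroup (Aff_mx (phi, psi, c)) -> phi \in unitmx /\ psi \in unitmx.
Proof.
have surj_unit (M : 'M[F]_2) : (forall b, exists x : 'cV_2, M *m x = b) -> M \in unitmx.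
  move=> M_surj; rewrite unitmxE unitfE; apply/negP=> /det0P[r r_neq0 rM].
  move/eqP: r_neq0; apply; apply/rowP=> j; have [x xE] := M_surj (delta_mx j 0).
  have : r *m delta_mx j 0 = 0 :> 'M_1 by rewrite -xE mulmxA rM mul0mx.
  by rewrite -colE => /colP/(_ 0); rewrite !mxE.
move=> qg; split; apply: surj_unit => b; have [[x [xE _]] [y [yE _]]] := qg 0 (b + c).
  by exists y; move: yE; rewrite /= /Aff mulmx0 addr0 => /addIr.
by exists x; move: xE; rewrite /= /Aff mulmx0 add0r => /addIr.
Qed.

Lemma mulmx_col_inj (F : fieldType) (M N : 'M[F]_2) :
  (forall x : 'cV_2, M *m x = N *m x) -> M = N.
Proof.
move=> MN; apply/trmx_inj/row_matrixP=> i; rewrite -!tr_col; congr (_^T).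
by rewrite !colE.
Qed.

Lemma paramedial_Aff_mx (F : fieldType) (phi psi : 'M[F]_2) c :
  paramedial (Aff_mx (phi, psi, c)) <-> phi *m phi = psi *m psi.
Proof.
split=> [pm|sq_eq x y u v].
  apply: mulmx_col_inj => x; have := pm x 0 0 0; rewrite /= /Aff !mulmx0 !add0r.
  rewrite !addr0 !mulmxDr !mulmxA => e; apply: (addIr (phi *m c + psi *m c + c)).
  move: (_ *m x) (_ *m x) (phi *m c) (psi *m c) e => X Y P Q e.
  by apply: etrans (etrans e _); apply/colP=> i; rewrite !mxE; ring.
rewrite /= /Aff !mulmxDr !mulmxA sq_eq.
move: (_ *m x) (_ *m y) (_ *m u) (_ *m v) (phi *m c) (psi *m c) => X Y U V P Q.
by apply/colP=> i; rewrite !mxE; ring.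
Qed.

(** Irreducibility of the pair acting on column vectors. *)
Definition no_common_col (F : fieldType) (phi psi : 'M[F]_2) : Prop :=
  forall (v : 'cV[F]_2) x y, phi *m v = x *: v -> psi *m v = y *: v -> v = 0.

(** A congruence e is translation invariant: e x y implies
    e (phi x + w) (phi y + w) for all w, and phi permutes the finite set of
    related pairs. The class of 0 is then a subgroup stable under phi and psi;
    if it contains u <> 0 but is not everything, phi u and psi u are multiples
    of u. *)
Lemma no_common_col_Aff_mx_simple (p : nat) (phi psi : 'M['F_p]_2) c :
  phi \in unitmx -> psi \in unitmx -> no_common_col phi psi ->
  simple_quasigroup (Aff_mx (phi, psi, c)).
Proof.
move=> phi_unit psi_unit irr e [e_eqv e_op].
have e_refl x : e x x by have [] := e_eqv x x x.
have e_trans y x z : e x y -> e y z -> e x z by move=> exy; have [_ ->] := e_eqv x y z.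
have e_phi w x y : e x y -> e (phi *m x + w) (phi *m y + w).
  move=> exy; have /= := e_op x y (invmx psi *m (w - c)) _ exy (e_refl _).
  by rewrite /Aff mulKVmx // -!(addrA (phi *m _)) subrK.
have e_psi w x y : e x y -> e (psi *m x + w) (psi *m y + w).
  move=> exy; have /= := e_op (invmx phi *m (w - c)) _ x y (e_refl _) exy.
  have wcK z : w - c + z + c = z + w by rewrite addrAC subrK addrC.
  by rewrite /Aff mulKVmx // !wcK.
have phi_inj : injective (mulmx phi : 'cV_2 -> _) := can_inj (mulKmx phi_unit).
have e_add w x y : e x y -> e (x + w) (y + w).
  (* Pairs in e are permuted by phi, hence every one is the image of such a pair. *)
  pose T := [set xy | e xy.1 xy.2]; pose f (xy : 'cV_2 * 'cV_2) := (phi *m xy.1, phi *m xy.2).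
  have f_inj : injective f by move=> [u v] [u' v'] [/phi_inj -> /phi_inj ->].
  have fT : f @: T = T.
    apply/eqP; rewrite eqEcard card_imset // leqnn andbT.
    apply/subsetP=> xy /imsetP[uv euv ->]; rewrite inE in euv.
    by rewrite inE /= -[phi *m uv.1]addr0 -[phi *m uv.2]addr0 e_phi.
  move=> exy; have /imsetP[[u v]] : (x, y) \in f @: T by rewrite fT inE.
  by rewrite inE /= => euv [-> ->]; apply: e_phi.
have e0D u v : e u 0 -> e v 0 -> e (u + v) 0.
  by move=> eu; apply: e_trans; have := e_add v _ _ eu; rewrite add0r.
have e0Z a u : e u 0 -> e (a *: u) 0.
  rewrite -(natr_Zp a) scaler_nat => eu.
  by elim: (val a) => [|n IHn]; rewrite ?mulr0n // mulrS e0D.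
have e0_phi u : e u 0 -> e (phi *m u) 0.
  by move/(e_phi 0); rewrite mulmx0 !addr0.
have e0_psi u : e u 0 -> e (psi *m u) 0.
  by move/(e_psi 0); rewrite mulmx0 !addr0.
have eB x y : e x y = e (x - y) 0.
  apply/idP/idP => [/(e_add (- y))|/(e_add y)]; first by rewrite subrr.
  by rewrite subrK add0r.
have [/forallP triv|] := boolP [forall u, e u 0 ==> (u == 0)].
  left=> x y; rewrite eB -subr_eq0; apply/idP/eqP=> [exy|-> //].
  by apply/eqP/(implyP (triv _)).
case/forallPn=> u; rewrite negb_imply => /andP[eu u_neq0]; right=> x y; rewrite eB.
have uT_neq0 : u^T != 0 by rewrite trmx_eq0.
have basis w : e w 0 -> rows2 u^T w^T \in unitmx -> forall v, e v 0.
  move=> ew b v; rewrite -[v]trmxK -[v^T](mulmxKV b) mulmx_sum_row big_ord_recl big_ord1.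
  by rewrite !rowK /= linearD !linearZ /= !trmxK e0D ?e0Z.
have [/basis -> //|nphi] := boolP (rows2 u^T (phi *m u)^T \in unitmx); first exact: e0_phi.
have [/basis -> //|npsi] := boolP (rows2 u^T (psi *m u)^T \in unitmx); first exact: e0_psi.
have [a aE] := rows2_dependent uT_neq0 nphi.
have [b bE] := rows2_dependent uT_neq0 npsi.
case/eqP: u_neq0; apply: (irr _ a b); apply: trmx_inj; by rewrite linearZ.
Qed.

Lemma Aff_mx_simple_paramedial (p : nat) (phi psi : 'M['F_p]_2) c :
  prime p -> phi \in unitmx -> psi \in unitmx -> phi *m phi = psi *m psi ->
  no_common_col phi psi ->
  simple_paramedial_quasigroup_of_order (p ^ 2) (Aff_mx (phi, psi, c)).
Proof.
move=> p_pr phi_unit psi_unit sq_eq irr; split.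
- move=> a b; split.
    exists (invmx psi *m (b - c - phi *m a)); split.
      by rewrite /= /Aff mulKVmx // addrCA subrr addr0 subrK.
    by move=> x <-; rewrite /= /Aff addrK addrAC subrr add0r mulKmx.
  exists (invmx phi *m (b - c - psi *m a)); split.
    by rewrite /= /Aff mulKVmx // !subrK.
  by move=> x <-; rewrite /= /Aff !addrK mulKmx.
- exact/paramedial_Aff_mx.
- exact: no_common_col_Aff_mx_simple.
by rewrite card_mx card_Fp.
Qed.

(** * Paramedial quasigroups are affine over abelian groups *)

Record abelian_law (A : Type) := AbelianLaw {
  law_add : A -> A -> A;
  law_zero : A;
  law_opp : A -> A;
  law_addA : associative law_add;
  law_addC : commutative law_add;
  law_add0 : left_id law_zero law_add;
  law_addN : left_inverse law_zero law_opp law_add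
}.

(** A translate of an endomorphism: f (x + y) + f 0 = f x + f y. *)
Definition law_affine (A : Type) (G : abelian_law A) (f : A -> A) : Prop :=
  forall x y, law_add G (f (law_add G x y)) (f (law_zero G)) = law_add G (f x) (f y).

(** With al x = x * o and be y = o * y, define + by x * y = al x + be y; it is
    a loop with zero o * o. Paramediality becomes an identity relating four
    loop elements. Setting some of them to zero expresses al (x + y) and
    be (x + y) through the one-sided translations rho and lam, and
    substituting back yields (y + x) + (w + u) = (y + w) + (x + u). A medial
    loop is an abelian group, and the first relations then say that al and be
    are affine. *)
Lemma paramedial_affine (A : finType) (op : A -> A -> A) (o : A) :
  quasigroup op -> paramedial op ->
  exists (G : abelian_law A) (alpha beta : A -> A),
    [/\ law_affine G alpha, law_affine G beta &
        forall x y, op x y = law_add G (alpha x) (beta y)].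
Proof.
move=> qg pm.
have opI a : injective (op a).
  move=> x y exy; have [[z [_ zU]] _] := qg a (op a x).
  by rewrite -(zU x) // -(zU y).
have opIr a : injective (op^~ a).
  move=> x y exy; have [_ [z [_ zU]]] := qg a (op x a).
  by rewrite -(zU x) // -(zU y).
pose al := op^~ o; pose be := op o.
have [al' alK al'K] : bijective al := injF_bij (opIr o).
have [be' beK be'K] : bijective be := injF_bij (opI o).
pose add x y := op (al' x) (be' y); pose zero := op o o.
have opE x y : op x y = add (al x) (be y) by rewrite /add alK beK.
have al'0 : al' zero = o by rewrite -[zero]/(al o) alK.
have be'0 : be' zero = o by rewrite -[zero]/(be o) beK.
have add0x x : add zero x = x by rewrite /add al'0 -/(be _) be'K.
have addx0 x : add x zero = x by rewrite /add be'0 -/(al _) al'K.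
have addI x : injective (add x) by move=> y z /opI/(can_inj be'K).
have addIr x : injective (add^~ x) by move=> y z /opIr/(can_inj al'K).
pose ga x := al (be' x); pose de x := be (al' x).
have gaK x : de (ga x) = x by rewrite /de /ga alK be'K.
have deK x : ga (de x) = x by rewrite /de /ga beK al'K.
have ga0 : ga zero = zero by rewrite /ga be'0.
have main X Y U V : add (al (add X Y)) (be (add U V)) =
    add (al (add (ga V) Y)) (be (add U (de X))).
  (* Paramediality at these four elements, so that X, Y, U, V are the summands. *)
  have := pm (al' X) (be' Y) (al' U) (be' V); rewrite !opE !al'K !be'K.
  by rewrite -/(ga V) -/(de X).
have main_V0 X Y U : add (al (add X Y)) (be U) = add (al Y) (be (add U (de X))).
  by have := main X Y U zero; rewrite ga0 add0x addx0.
pose rho x := add x (be zero); pose lam := add (al zero).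
have [rho' rhoK rho'K] : bijective rho := injF_bij (addIr _).
have [lam' lamK lam'K] : bijective lam := injF_bij (addI _).
have al_add X Y : al (add X Y) = rho' (add (al Y) (be (de X))).
  by rewrite -(add0x (de X)) -main_V0 -/(rho _) rhoK.
have be_add U V : be (add U V) = lam' (add (al (ga V)) (be U)).
  by rewrite -(addx0 (ga V)) main_V0 gaK -/(lam _) lamK.
have mainP y u X W :
    add (rho' (add y (be (de X)))) (lam' (add (al W) u)) =
    add (rho' (add y (be (de W)))) (lam' (add (al X) u)).
  rewrite -[y]al'K -[u]be'K -!al_add.
  have bE' U Z : lam' (add (al Z) (be U)) = be (add U (de Z)) by rewrite be_add deK.
  by rewrite !bE' main deK.
have rho'0 : rho' (be zero) = zero by rewrite -{1}[be zero]add0x -/(rho _) rhoK.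
have lam'0 : lam' (al zero) = zero by rewrite -{1}[al zero]addx0 -/(lam _) lamK.
have de0 : de zero = zero by rewrite /de al'0.
have rho_lam X : rho' (be (de X)) = lam' (al X).
  by have := mainP zero zero X zero; rewrite !add0x !addx0 de0 lam'0 rho'0 addx0 add0x.
have main_sigma y u x w :
    add (rho' (add y (rho x))) (lam' (add (lam w) u)) =
    add (rho' (add y (rho w))) (lam' (add (lam x) u)).
  have := mainP y u (al' (lam x)) (al' (lam w)).
  have deE z : be (de (al' (lam z))) = rho z.
    by rewrite -[LHS]rho'K rho_lam al'K lamK.
  by rewrite !deE !al'K.
have rho0 : rho zero = be zero by rewrite /rho add0x.
have lam0 : lam zero = al zero by rewrite /lam addx0.
have lamE x u : lam' (add (lam x) u) = add x u.
  have := main_sigma zero u x zero; rewrite lam0 -/(lam u) lamK !add0x rhoK rho0 rho'0.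
  by rewrite add0x.
have rhoE y x : rho' (add y (rho x)) = add y x.
  have := main_sigma y zero x zero; rewrite rho0 -/(rho y) rhoK lam0 !addx0 lam'0 lamK.
  by rewrite addx0.
have medial y x w u : add (add y x) (add w u) = add (add y w) (add x u).
  by rewrite -(rhoE y x) -(lamE w u) main_sigma rhoE lamE.
have addC : commutative add.
  by move=> x w; have := medial zero x w zero; rewrite !add0x !addx0.
have addA : associative add.
  by move=> y x u; have := medial y x zero u; rewrite add0x addx0.
pose opp x := be (invF (opI (al' x)) zero).
have addN : left_inverse zero opp add.
  by move=> x; rewrite addC /add /opp beK f_invF.
have al_de X : add (al X) (be zero) = add (al zero) (be (de X)).
  by have := main_V0 X zero zero; rewrite addx0 add0x.
exists (AbelianLaw addA addC add0x addN), al, be; split=> //= x y.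
  apply: (addIr (be zero)) => /=.
  have -> : add (add (al (add x y)) (al zero)) (be zero) =
      add (add (al (add x y)) (be zero)) (al zero) by rewrite -!addA [add (be _) _]addC.
  by rewrite main_V0 add0x -addA [add (be _) _]addC -al_de addA [add (al y) _]addC.
apply: (addI (al zero)).
have -> : add (al zero) (add (be (add x y)) (be zero)) =
    add (add (al zero) (be (add x y))) (be zero) by rewrite addA.
rewrite -{1}[y]gaK -main_V0 addx0 -addA [add (be x) _]addC addA al_de gaK.
by rewrite -addA [add (be y) _]addC.
Qed.

(** Carries the multiplicative finite group structure of the law G, so that
    the theory of elementary abelian groups applies. *)
Definition law_group (A : finType) (G : abelian_law A) : Type := A.

HB.instance Definition _ (A : finType) (G : abelian_law A) := Finite.on (law_group G).
HB.instance Definition _ (A : finType) (G : abelian_law A) :=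
  Finite_isGroup.Build (law_group G) (law_addA G) (law_add0 G) (law_addN G).

(** In additive notation, f (n x) + n f 0 = n f x + f 0; hence n f x depends
    only on n x. *)
Lemma law_affine_expg (A : finType) (G : abelian_law A) (f : law_group G -> law_group G) :
  law_affine G f -> forall x n, (f (x ^+ n) * f 1 ^+ n = f x ^+ n * f 1)%g.
Proof.
move=> f_aff x n; elim: n => [|n IHn]; first by rewrite !expg0 mul1g mulg1.
rewrite !expgS mulgA [(f _ * _)%g]f_aff -!mulgA; congr (_ * _)%g; exact: IHn.
Qed.

(** The relation x^p = y^p is a congruence. It is not equality, because
    Cauchy's theorem provides an element of order p, so it is full and the
    group is elementary abelian of rank 2. *)
Lemma simple_paramedial_coordinates (p : nat) (A : finType) (op : A -> A -> A) :
  prime p -> simple_paramedial_quasigroup_of_order (p ^ 2) op ->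
  exists phi psi c, qg_isomorphic op (Aff_mx ((phi, psi, c) : aff_data 'F_p)).
Proof.
move=> p_pr [qg pm simpl cardA].
have [o _] : exists o : A, o \in A.
  by apply/card_gt0P; rewrite cardA expn_gt0 prime_gt0.
have [G [al [be [al_aff be_aff opE]]]] := paramedial_affine o qg pm.
pose gT : finGroupType := law_group G.
have mulgC (x y : gT) : (x * y = y * x)%g by exact: (law_addC G).
have cardT : #|[set: gT]| = (p ^ 2)%N
  by rewrite cardsT -cardA; apply: (@bij_eq_card gT A id); exists id.
have affX (f : gT -> gT) : law_affine G f -> forall x y : gT,
    (x ^+ p = y ^+ p)%g -> (f x ^+ p = f y ^+ p)%g.
  move=> f_aff x y exy; apply: (mulIg (f 1%g)).
  by rewrite -!(law_affine_expg f_aff) exy.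
have expp (x : gT) : (x ^+ p = 1)%g.
  have [] := simpl (fun x y : A => ((x : gT) ^+ p == (y : gT) ^+ p)%g).
  - split; first by move=> u v w; split=> // /eqP ->.
    move=> u u' v v' /eqP eu /eqP ev; rewrite !opE; apply/eqP.
    have mulX (s t : gT) : ((s * t) ^+ p = s ^+ p * t ^+ p)%g by rewrite expgMn //; apply: mulgC.
    rewrite [LHS](mulX (al u) (be v)) [RHS](mulX (al u') (be v')).
    by rewrite (affX _ al_aff u u') // (affX _ be_aff v v').
  - move=> inj; have [|y _ y_ord] := @Cauchy gT p [set: gT] p_pr.
      by rewrite cardT dvdn_exp.
    have := inj y (1%g : gT); rewrite -{1}y_ord expg_order expg1n eqxx => /esym/eqP y1.
    by move: y_ord p_pr; rewrite y1 order1 => <-.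
  by move/(_ x (1%g : gT)) => /eqP ->; rewrite expg1n.
have abelT : (p.-abelem [set: gT])%g.
  apply/abelemP => //; split; last by move=> x _; apply: expp.
  by apply/centsP=> x _ y _; apply: mulgC.
have ntT : [set: gT] != 1%g.
  apply/eqP=> T1; move: cardT; rewrite T1 cards1 => /esym/eqP.
  by rewrite -[1%N](exp1n 2) eqn_exp2r // => /eqP p1; move: p_pr; rewrite p1.
have := abelem_rV_M abelT ntT; have := @abelem_rV_inj _ _ _ abelT ntT.
set f := abelem_rV abelT ntT; move: f; rewrite (dim_abelemE abelT ntT) cardT pfactorK //.
move=> f f_inj f_mul; pose F (x : A) := (f x)^T.
have F_inj : injective F by move=> x y /trmx_inj/f_inj -> //; rewrite inE.
have [F' FK F'K] : bijective F.
  by apply: inj_card_bij => //; rewrite cardA card_mx card_Fp.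
have F_add x y : F (law_add G x y) = F x + F y.
  by rewrite /F -raddfD -f_mul ?inE.
have F'_add u v : F' (u + v) = law_add G (F' u) (F' v).
  by apply: (can_inj FK); rewrite F_add !F'K.
have F'0 : F' 0 = law_zero G.
  apply: (can_inj FK); rewrite F'K; apply: (addrI (F (law_zero G))).
  by rewrite -F_add law_add0 addr0.
have affine_mx g : law_affine G g -> exists M b, forall x, F (g x) = M *m F x + b.
  move=> g_aff; have [u v|M ME] := @additive_mulmx p 2 (fun v => F (g (F' v)) - F (g (F' 0))).
    apply: (addIr (F (g (F' 0)) + F (g (F' 0)))).
    rewrite F'_add F'0 addrA subrK -[LHS]F_add g_aff F_add.
    by rewrite [RHS]addrACA !subrK.
  by exists M, (F (g (F' 0))) => x; rewrite -ME FK subrK.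
have [phi [b phiE]] := affine_mx _ al_aff; have [psi [c psiE]] := affine_mx _ be_aff.
exists phi, psi, (b + c), F; first by exists F'.
by move=> x y; rewrite /= /Aff opE F_add phiE psiE addrACA.
Qed.

(** * Irreducible quadratics and squares modulo an odd prime *)

Lemma irr_quadE (F : finFieldType) (a b : F) :
  irr_quad a b = [forall x, x ^+ 2 != b * x + a].
Proof.
have rootE x : root ('X^2 - b *: 'X - a%:P) x = (x ^+ 2 == b * x + a).
  by rewrite rootE !hornerE -[RHS]subr_eq0 opprD addrA.
have size3 : size ('X^2 - b *: 'X - a%:P : {poly F}) = 3%N.
  rewrite -addrA -opprD size_polyDl ?size_polyXn // size_polyN.
  rewrite (leq_ltn_trans (size_polyD _ _)) // gtn_max.
  rewrite (leq_ltn_trans (size_scale_leq _ _)) ?size_polyX //.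
  by rewrite (leq_ltn_trans (size_polyC_leq1 _)).
apply/irreducibleP/forallP => [[_ irr] x|no_root].
  rewrite -rootE -dvdp_XsubCl; apply/negP=> /irr; rewrite size_XsubC => /(_ isT).
  by move/eqp_size; rewrite size_XsubC size3.
by apply: cubic_irreducible => [|x]; rewrite ?size3 // rootE.
Qed.

Lemma irr_sqE (F : finFieldType) (a : F) : irr_sq a = [forall x, x ^+ 2 != a].
Proof.
rewrite /irr_sq; have := irr_quadE a 0; rewrite /irr_quad scale0r subr0 => ->.
by apply: eq_forallb => x; rewrite mul0r add0r.
Qed.

Lemma irr_sqP (F : finFieldType) (a : F) :
  reflect (forall x, x ^+ 2 != a) (irr_sq a).
Proof. by rewrite irr_sqE; apply: forallP. Qed.

Lemma irr_quadP (F : finFieldType) (a b : F) :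
  reflect (forall x, x ^+ 2 - b * x - a != 0) (irr_quad a b).
Proof.
rewrite irr_quadE; apply: (iffP forallP) => no_root x.
  by rewrite -addrA -opprD subr_eq0.
by rewrite -subr_eq0 opprD addrA.
Qed.

(** Completing the square: x^2 - b x - a has a root exactly when its
    discriminant b^2 + 4 a is a square. *)
Lemma irr_quad_discriminant (F : finFieldType) (a b : F) :
  (2 : F) != 0 -> irr_quad a b = irr_sq (b ^+ 2 + 4 * a).
Proof.
move=> two_neq0; have four_neq0 : (4 : F) != 0 by rewrite (natrM _ 2 2) mulf_neq0.
apply/irr_quadP/irr_sqP => no_root x.
  have /eqP n := no_root ((x + b) / 2); apply/eqP => xE; apply: n.
  apply: (mulfI four_neq0); rewrite mulr0.
  have -> : a = (x ^+ 2 - b ^+ 2) / 4 by rewrite xE; field.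
  by field; rewrite two_neq0 four_neq0.
have /eqP n := no_root (2 * x - b); apply/eqP => xE; apply: n.
apply/eqP; rewrite -subr_eq0 -[X in _ == X](mulr0 4) -xE; apply/eqP; ring.
Qed.

Lemma Fp_two_neq0 (p : nat) : prime p -> odd p -> (2 : 'F_p) != 0.
Proof.
move=> p_pr p_odd; rewrite -(dvdn_pcharf (pchar_Fp p_pr)).
by apply: contraL p_odd => /(dvdn_leq (isT : 0 < 2)%N); case: p p_pr => [|[|[|p]]].
Qed.

(** One representative of each pair of opposite nonzero residues. *)
Definition lower_half (p : nat) : {set 'F_p} :=
  [set a : 'F_p | (0 < a)%N && (a < (- a)%R)%N].

Lemma lower_half_neq0 (p : nat) (a : 'F_p) : a \in lower_half p -> a != 0.
Proof. by rewrite inE lt0n => /andP[]. Qed.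

Lemma lower_halfN (p : nat) (a : 'F_p) : a \in lower_half p -> - a \notin lower_half p.
Proof. by rewrite !inE opprK => /andP[_ lt]; rewrite negb_and -!leqNgt (ltnW lt) orbT. Qed.

Lemma lower_half_cases (p : nat) (a : 'F_p) :
  prime p -> odd p -> a != 0 -> (a \in lower_half p) || (- a \in lower_half p).
Proof.
move=> p_pr p_odd a_neq0; have aN_neq0 : - a != 0 by rewrite oppr_eq0.
have pos (b : 'F_p) : b != 0 -> (0 < b)%N by rewrite lt0n.
rewrite !inE opprK !pos //=; case: ltngtP => // /(@ord_inj _ a (- a))/eqP.
by rewrite -addr_eq0 -mulr2n -mulr_natl mulf_eq0 (negPf a_neq0) (negPf (Fp_two_neq0 p_pr p_odd)).
Qed.

Lemma card_lower_half (p : nat) : prime p -> odd p -> (#|lower_half p|.*2)%N = p.-1.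
Proof.
move=> p_pr p_odd; pose N := [set - a | a in lower_half p].
have cardN : #|N| = #|lower_half p| by rewrite card_imset //; apply: oppr_inj.
have NE a : (a \in N) = (- a \in lower_half p).
  by apply/imsetP/idP=> [[b bh ->]|ah]; [rewrite opprK|exists (- a); rewrite ?opprK].
have dis : [disjoint lower_half p & N].
  by rewrite -setI_eq0; apply/eqP/setP=> a; rewrite in_setI NE in_set0;
    case: (boolP (a \in lower_half p)) => //= /lower_halfN/negPf.
have UE : lower_half p :|: N = [set~ 0].
  apply/setP=> a; rewrite in_setU NE in_setC1; apply/orP/idP=> [[/lower_half_neq0 //|]|].
    by move/lower_half_neq0; rewrite oppr_eq0.
  by move/(lower_half_cases p_pr p_odd)/orP.
have := cardsUI (lower_half p) N; rewrite UE cardsC1 card_Fp // cardN.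
by move: dis; rewrite -setI_eq0 => /eqP ->; rewrite cards0 addn0 addnn => ->.
Qed.

Lemma sqr_inj_lower_half (p : nat) : {in lower_half p &, injective (fun x : 'F_p => x ^+ 2)}.
Proof.
move=> x y xh yh /eqP; rewrite eqf_sqr => /orP[/eqP //|/eqP xE].
by move: (lower_halfN yh); rewrite -xE xh.
Qed.

Definition nonzero_squares (p : nat) : {set 'F_p} := [set x ^+ 2 | x in lower_half p].

Lemma card_nonzero_squares (p : nat) : #|nonzero_squares p| = #|lower_half p|.
Proof. exact: card_in_imset (@sqr_inj_lower_half p). Qed.

Lemma nonzero_squares0 (p : nat) : 0 \notin nonzero_squares p.
Proof.
by apply/imsetP=> -[x /lower_half_neq0 x_neq0 /esym/eqP]; rewrite expf_eq0 (negPf x_neq0).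
Qed.

Lemma irr_sqNsquare (p : nat) (a : 'F_p) : prime p -> odd p ->
  irr_sq a = (a \notin 0 |: nonzero_squares p).
Proof.
move=> p_pr p_odd; apply/irr_sqP/idP => [nsq|].
  rewrite !inE negb_or; apply/andP; split.
    by apply: contra (nsq 0) => /eqP ->; rewrite expr0n.
  by apply/imsetP=> -[x _ /esym/eqP]; apply/negP.
rewrite !inE negb_or => /andP[a_neq0 /imsetP nsq] x; apply/eqP=> xE; apply: nsq.
have x_neq0 : x != 0 by apply: contra a_neq0 => /eqP x0; rewrite -xE x0 expr0n.
have /orP[xh|xh] := lower_half_cases p_pr p_odd x_neq0; [exists x|exists (- x)] => //.
by rewrite sqrrN.
Qed.

Lemma card_irr_sq (p : nat) : prime p -> odd p -> #|[set a : 'F_p | irr_sq a]| = #|lower_half p|.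
Proof.
move=> p_pr p_odd.
have -> : [set a : 'F_p | irr_sq a] = ~: (0 |: nonzero_squares p).
  by apply/setP=> a; rewrite inE irr_sqNsquare // in_setC.
have := cardsC (0 |: nonzero_squares p).
rewrite cardsU1 nonzero_squares0 card_nonzero_squares card_Fp //=.
have arith (h n : nat) : (1 + h + n = p)%N -> h.*2 = p.-1 -> n = h.
  by have := prime_gt0 p_pr; lia.
by move/arith; apply; apply: card_lower_half.
Qed.

Lemma irr_sq_neq0 (F : finFieldType) (a : F) : irr_sq a -> a != 0.
Proof. by move/irr_sqP/(_ 0); rewrite expr0n eq_sym. Qed.

(** In the variable m = l - t / (2 a) the equation reads k^2 = a m^2 + d. The
    squares and their image under y |-> a y + d have (p + 1) / 2 elements
    each, hence a common element. *)
Lemma exists_conic_point (p : nat) (a t : 'F_p) : prime p -> odd p -> a != 0 ->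
  exists k l, k ^+ 2 - a * l ^+ 2 + t * l - a = 0.
Proof.
move=> p_pr p_odd a_neq0; have two_neq0 := Fp_two_neq0 p_pr p_odd.
have four_neq0 : (4 : 'F_p) != 0 by rewrite (natrM _ 2 2) mulf_neq0.
pose S := 0 |: nonzero_squares p; pose d := a - t ^+ 2 / (4 * a).
pose f y := a * y + d; have f_inj : injective f by move=> x y /addIr/(mulfI a_neq0).
have SP s : s \in S -> exists x, s = x ^+ 2.
  rewrite !inE => /orP[/eqP ->|/imsetP[x _ ->]]; last by exists x.
  by exists 0; rewrite expr0n.
have [y /setIP[/SP[k ->] /imsetP[_ /SP[m ->] km]]] : exists y, y \in S :&: f @: S.
  apply/set0Pn; rewrite -cards_eq0; apply/eqP=> I0.
  have := cardsUI S (f @: S); rewrite I0 card_imset // addn0.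
  have := max_card (mem (S :|: f @: S)); rewrite card_Fp // /S cardsU1.
  rewrite nonzero_squares0 card_nonzero_squares /=.
  have arith (n h : nat) : (n <= p)%N -> n = (1 + h + (1 + h))%N -> h.*2 <> p.-1.
    by have := prime_gt0 p_pr; lia.
  by move=> le_p e; apply: (arith _ _ le_p e); apply: card_lower_half.
(* Undo the completion of the square. *)
exists k, (m + t / (2 * a)); rewrite km /f /d; field.
by rewrite a_neq0 two_neq0 four_neq0.
Qed.

(** * Orbits under the centralizer of a companion matrix *)

(** The trace-zero matrices with the same square as comp_mx a 0 and a given
    trace of the product with it. *)
Definition level (F : finFieldType) (a t : F) : {set 'M[F]_2} :=
  [set M : 'M[F]_2 | [&& \tr M == 0, \det M == - a & \tr (comp_mx a 0 *m M) == t]].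

Lemma psi_kl_invariants (F : fieldType) (a k l : F) : l != 0 ->
  [/\ \tr (psi_kl a k l) = 0, \det (psi_kl a k l) = - a &
      \tr (comp_mx a 0 *m psi_kl a k l) = l^-1 * (a - k ^+ 2) + a * l].
Proof. by move=> l_neq0; rewrite /psi_kl /comp_mx !mx22E; split; field. Qed.

Lemma psi_kl_level (F : finFieldType) (a t k l : F) : l != 0 ->
  (psi_kl a k l \in level a t) = (k ^+ 2 - a * l ^+ 2 + t * l - a == 0).
Proof.
move=> l_neq0; rewrite inE; have [-> -> ->] := psi_kl_invariants a k l_neq0.
rewrite !eqxx /= -(inj_eq (mulfI l_neq0)) mulrDr mulVKf // eq_sym -subr_eq0.
by congr (_ == 0); ring.
Qed.

Lemma levelP (F : finFieldType) (a t : F) (M : 'M[F]_2) :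
  irr_sq a -> M \in level a t -> exists k l, l != 0 /\ M = psi_kl a k l.
Proof.
move=> /irr_sqP a_nsq; rewrite inE => /and3P[trM detM _].
have trE : \tr M = M 0 0 + M 1 1 by rewrite {1}[M]mx22_eta !mx22E.
have detE : \det M = M 0 0 * M 1 1 - M 0 1 * M 1 0 by rewrite {1}[M]mx22_eta !mx22E.
move: trM detM; rewrite trE detE addrC addr_eq0 => /eqP m11; rewrite m11 => /eqP detM.
exists (M 0 0), (M 0 1).
have aE : a = M 0 0 ^+ 2 + M 0 1 * M 1 0 by rewrite -[a]opprK -detM; ring.
have l_neq0 : M 0 1 != 0.
  by apply/eqP=> l0; have := a_nsq (M 0 0); rewrite aE l0 mul0r addr0 eqxx.
split=> //; apply: etrans (mx22_eta M) _; rewrite m11; congr mx22.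
by apply: (mulfI l_neq0); rewrite mulVKf // aE; ring.
Qed.

Lemma det_comp_mx (F : comNzRingType) (a b : F) : \det (comp_mx a b) = - a.
Proof. by rewrite !mx22E mul0r mul1r sub0r. Qed.

Lemma trace_comp_mx (F : nzRingType) (a b : F) : \tr (comp_mx a b) = b.
Proof. by rewrite !mx22E add0r. Qed.

(** The invariants tr, det and tr(phi psi) are constant on an orbit;
    conversely the normal form of the pair depends only on them. *)
Lemma conj_orbit_level (F : finFieldType) (a t : F) (psi : 'M[F]_2) :
  irr_sq a -> psi \in level a t -> conj_orbit (comp_mx a 0) psi = level a t.
Proof.
move=> a_nsq psi_lev; have := psi_lev; rewrite inE => /and3P[/eqP trpsi /eqP detpsi /eqP tE].
apply/setP=> M; apply/imsetP/idP => [[g]|M_lev].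
  rewrite inE => /andP[g_unit /eqP gC] ->; rewrite inE.
  have detg : \det g \is a GRing.unit by rewrite -unitmxE.
  rewrite mxtrace_mulC mulmxA mulVmx // mul1mx trpsi eqxx /=.
  rewrite !det_mulmx det_inv mulrAC mulrV // mul1r detpsi eqxx /=.
  by rewrite !mulmxA -gC -!mulmxA mxtrace_mulC !mulmxA mulmxKV // tE.
have [k [l [l_neq0 ME]]] := levelP a_nsq M_lev.
move: M_lev; rewrite ME psi_kl_level // => /eqP kl.
have [|||||g [g_unit gC gpsi]] :=
  @intertwines_psi_kl _ (comp_mx a 0) psi a k l (irr_sqP _ a_nsq) l_neq0;
  rewrite ?trace_comp_mx ?det_comp_mx ?tE //.
exists g; first by rewrite inE g_unit gC eqxx.
by rewrite gpsi mulmxK.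
Qed.

Lemma psi_kl_same (F : fieldType) (a : F) : psi_kl a 0 1 = comp_mx a 0.
Proof. by rewrite /psi_kl invr1 mul1r expr0n subr0 oppr0. Qed.

Lemma psi_kl_opposite (F : fieldType) (a : F) : psi_kl a 0 (-1) = - comp_mx a 0.
Proof. by rewrite /psi_kl invrN1 mulN1r expr0n subr0 oppr0 opp_mx22 oppr0. Qed.

(** Anisotropy of the form k^2 - a m^2. *)
Lemma square_eq_nonsquare_mul (F : finFieldType) (a k m : F) :
  irr_sq a -> k ^+ 2 = a * m ^+ 2 -> k = 0 /\ m = 0.
Proof.
move=> /irr_sqP a_nsq; have [-> /eqP|m_neq0 e] := eqVneq m 0.
  by rewrite expr0n mulr0 sqrf_eq0 => /eqP.
by have := a_nsq (k / m); rewrite expr_div_n e mulfK ?eqxx // expf_neq0.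
Qed.

Lemma level_same (F : finFieldType) (a k l : F) : irr_sq a -> l != 0 ->
  (psi_kl a k l \in level a (2 * a)) = ((k, l) == (0, 1)).
Proof.
move=> a_nsq l_neq0; rewrite psi_kl_level //; apply/eqP/eqP => [e|[-> ->]]; last by ring.
have [|-> /eqP] := @square_eq_nonsquare_mul _ a k (l - 1) a_nsq.
  by apply/eqP; rewrite -subr_eq0 -e; apply/eqP; ring.
by rewrite subr_eq0 => /eqP ->.
Qed.

Lemma level_opposite (F : finFieldType) (a k l : F) : irr_sq a -> l != 0 ->
  (psi_kl a k l \in level a (- (2 * a))) = ((k, l) == (0, -1)).
Proof.
move=> a_nsq l_neq0; rewrite psi_kl_level //; apply/eqP/eqP => [e|[-> ->]]; last by ring.
have [|-> /eqP] := @square_eq_nonsquare_mul _ a k (l + 1) a_nsq.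
  by apply/eqP; rewrite -subr_eq0 -e; apply/eqP; ring.
by rewrite addr_eq0 => /eqP ->.
Qed.

Lemma conic_point_l_neq0 (F : finFieldType) (a t k l : F) :
  irr_sq a -> k ^+ 2 - a * l ^+ 2 + t * l - a = 0 -> l != 0.
Proof.
move=> /irr_sqP a_nsq e; apply/eqP=> l0; move: e.
rewrite l0 expr0n !mulr0 subr0 addr0 => /eqP; rewrite subr_eq0.
by apply/negP.
Qed.

Lemma conicE (F : finFieldType) (a k l : F) : l != 0 ->
  conic a k l = (psi_kl a k l \in level a (1 - 2 * a)).
Proof. by move=> l_neq0; rewrite psi_kl_level. Qed.

Lemma level_inj (F : finFieldType) (a t t' : F) (M : 'M[F]_2) :
  M \in level a t -> M \in level a t' -> t = t'.
Proof. by rewrite !inE => /and3P[_ _ /eqP <-] /and3P[_ _ /eqP]. Qed.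

Lemma level_nonempty (p : nat) (a t : 'F_p) : prime p -> odd p -> irr_sq a ->
  exists k l, l != 0 /\ psi_kl a k l \in level a t.
Proof.
move=> p_pr p_odd a_nsq.
have [k [l kl]] := exists_conic_point t p_pr p_odd (irr_sq_neq0 a_nsq).
have l_neq0 := conic_point_l_neq0 a_nsq kl.
by exists k, l; rewrite psi_kl_level // kl eqxx.
Qed.

(** Orbits correspond to the values t of tr(phi psi). The values 2 a and
    - 2 a are taken only at psi = phi and psi = - phi, and the orbit
    for 1 - 2 a is the one made of points of the conic. *)
Lemma fam4_orbits_level (p : nat) (a : 'F_p) : prime p -> odd p -> irr_sq a ->
  fam4_orbits a = [set level a t | t in ~: [set 2 * a; - (2 * a); 1 - 2 * a]].
Proof.
move=> p_pr p_odd a_nsq.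
have sub_conic t : (level a t \subset [set M : 'M_2 | conic a (M 0 0) (M 0 1)])
    = (t == 1 - 2 * a).
  have in_conic k l u : l != 0 -> psi_kl a k l \in level a u ->
      (psi_kl a k l \in [set M : 'M_2 | conic a (M 0 0) (M 0 1)]) = (u == 1 - 2 * a).
    move=> l_neq0 lev; rewrite inE !mxE /= conicE //.
    by apply/idP/eqP=> [|<- //]; apply: level_inj.
  apply/idP/eqP => [/subsetP sub|tE].
    have [k [l [l_neq0 lev]]] := level_nonempty t p_pr p_odd a_nsq.
    by have := sub _ lev; rewrite (in_conic _ _ _ l_neq0 lev) => /eqP.
  apply/subsetP=> M M_lev; have [k [l [l_neq0 ME]]] := levelP a_nsq M_lev.
  by move: M_lev; rewrite ME => /(in_conic _ _ _ l_neq0) ->; apply/eqP.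
apply/setP=> O; apply/setIdP/imsetP => [[/imsetP[psi psi4 ->]]|[t]].
  case/imset2P: psi4 => k l _; rewrite !inE /= => /and3P[l_neq0 nsame nopp] ->.
  have lev : psi_kl a k l \in level a (\tr (comp_mx a 0 *m psi_kl a k l)).
    by rewrite inE; have [-> -> _] := psi_kl_invariants a k l_neq0; rewrite !eqxx.
  rewrite (conj_orbit_level a_nsq lev) sub_conic => not_conic.
  eexists; last by [].
  rewrite !inE !negb_or not_conic andbT; apply/andP; split.
    by apply: contra nsame => /eqP tE; rewrite -(level_same k a_nsq l_neq0) -tE.
  by apply: contra nopp => /eqP tE; rewrite -(level_opposite k a_nsq l_neq0) -tE.
rewrite !inE !negb_or -andbA => /and3P[t1 t2 t3] ->; rewrite sub_conic; split=> //.
have [k [l [l_neq0 lev]]] := level_nonempty t p_pr p_odd a_nsq.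
apply/imsetP; exists (psi_kl a k l); last by rewrite (conj_orbit_level a_nsq lev).
apply/imset2P; exists k l => //; rewrite !inE /= l_neq0 -(level_same k a_nsq l_neq0).
rewrite -(level_opposite k a_nsq l_neq0) /=; apply/andP.
by split; [apply: contra t1|apply: contra t2] => lev'; apply/eqP; apply: level_inj lev _.
Qed.

Lemma level_family_injective (p : nat) (a : 'F_p) : prime p -> odd p -> irr_sq a ->
  injective (level a).
Proof.
move=> p_pr p_odd a_nsq t t' e.
have [k [l [_ lev]]] := level_nonempty t p_pr p_odd a_nsq.
by apply: (level_inj lev); rewrite -e.
Qed.

Lemma excluded_levels_distinct (F : finFieldType) (a : F) : (2 : F) != 0 -> irr_sq a ->
  [/\ 2 * a != - (2 * a), 2 * a != 1 - 2 * a & - (2 * a) != 1 - 2 * a].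
Proof.
move=> two_neq0 a_nsq; have a_neq0 := irr_sq_neq0 a_nsq.
have d1 : 2 * a != - (2 * a).
  rewrite -addr_eq0; have -> : 2 * a + 2 * a = 2 * (2 * a) by ring.
  by rewrite !mulf_neq0.
have not_quarter : (2 * a) * 2 != 1.
  apply/eqP=> e; have /negP := irr_sqP _ a_nsq 2^-1; apply; apply/eqP.
  have : 2^-1 ^+ 2 * (2 * a * 2) = a by field.
  by rewrite e mulr1.
have d2 : 2 * a != 1 - 2 * a.
  apply: contra not_quarter => /eqP e; apply/eqP.
  have -> : 2 * a * 2 = 2 * a + 2 * a by ring.
  by rewrite {1}e subrK.
have d3 : - (2 * a) != 1 - 2 * a.
  by apply/eqP=> e; move/eqP: (oner_neq0 F); apply; apply: (addIr (- (2 * a))); rewrite add0r -e.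
by split.
Qed.

Lemma card_fam4_orbits (p : nat) (a : 'F_p) : prime p -> odd p -> irr_sq a ->
  #|fam4_orbits a| = (p - 3)%N.
Proof.
move=> p_pr p_odd a_nsq; rewrite fam4_orbits_level // card_imset; last first.
  exact: level_family_injective.
have [d1 d2 d3] := excluded_levels_distinct (Fp_two_neq0 p_pr p_odd) a_nsq.
have card3 : #|[set 2 * a; - (2 * a); 1 - 2 * a]| = 3%N.
  by rewrite setUC cardsU1 !inE cards2 d1 negb_or eq_sym d2 eq_sym d3.
have := cardsC [set 2 * a; - (2 * a); 1 - 2 * a].
by rewrite card3 card_Fp // => e; rewrite -[X in (X - _)%N]e addKn.
Qed.

Lemma fam4_orbits_trivIset (p : nat) (a : 'F_p) : prime p -> odd p -> irr_sq a ->
  trivIset (fam4_orbits a).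
Proof.
move=> p_pr p_odd a_nsq; apply/trivIsetP=> A B.
rewrite fam4_orbits_level // => /imsetP[t _ ->] /imsetP[t' _ ->]; apply: contraR.
case/pred0Pn=> M /andP[/= Mt Mt']; by rewrite (level_inj Mt Mt').
Qed.

Lemma fam4_orbits_no_set0 (p : nat) (a : 'F_p) : prime p -> odd p -> irr_sq a ->
  set0 \notin fam4_orbits a.
Proof.
move=> p_pr p_odd a_nsq; rewrite fam4_orbits_level //; apply/imsetP=> -[t _ e].
have [k [l [_]]] := level_nonempty t p_pr p_odd a_nsq.
by rewrite -e inE.
Qed.

(** Disjoint nonempty blocks partition their union, and the sets of
    representatives are the transversals of that partition. *)
Lemma orbit_representatives_transversal (T : finType) (P : {set {set T}}) (X : {set T}) :
  trivIset P -> set0 \notin P ->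
  orbit_representatives P X <-> is_transversal X P (cover P).
Proof.
move=> tP nP; have part : partition P (cover P) by apply/and3P.
split=> [[subX oneX]|/and3P[_ subX /forall_inP oneX]].
  by apply/and3P; split=> //; apply/forall_inP=> B /oneX ->.
by split=> // B /oneX/eqP.
Qed.

(** * The families and their invariants *)

Lemma col2_00 (F : nzRingType) : col2 (0 : F) 0 = 0.
Proof. by apply/colP=> i; rewrite !mxE; case: ifP. Qed.

Lemma mulmx22_eigenvector (F : fieldType) (a b c d x : F) (v : 'cV[F]_2) :
  mx22 a b c d *m v = x *: v ->
  a * v 0 0 + b * v 1 0 = x * v 0 0 /\ c * v 0 0 + d * v 1 0 = x * v 1 0.
Proof.
move/colP=> e; have := e 0; have := e 1; rewrite !mxE !big_ord_recl !big_ord0 !mxE /=.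
have -> : lift ord0 ord0 = 1 :> 'I_2 by apply: val_inj.
by rewrite !addr0.
Qed.

Lemma cV2_eq0 (F : nzRingType) (v : 'cV[F]_2) : v 0 0 = 0 -> v 1 0 = 0 -> v = 0.
Proof.
move=> v0 v1; apply/colP=> i; rewrite mxE.
by case: i => [[|[|//]] hi]; [rewrite -[RHS]v0|rewrite -[RHS]v1]; congr (v _ _); apply: val_inj.
Qed.

Lemma trace_fam1_phi (F : nzRingType) (a : F) : \tr (fam1_phi a) = 0.
Proof. by rewrite mx22E subrr. Qed.

Lemma trace_fam1_psi (F : nzRingType) (a k : F) : \tr (fam1_psi a k) = 0.
Proof. by rewrite mx22E subrr. Qed.

Lemma det_fam1_phi (F : comNzRingType) (a : F) : \det (fam1_phi a) = - a ^+ 2.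
Proof. by rewrite mx22E; ring. Qed.

Lemma det_fam1_psi (F : comNzRingType) (a k : F) : \det (fam1_psi a k) = - a ^+ 2.
Proof. by rewrite mx22E; ring. Qed.

Lemma trace_fam1_mul (F : comNzRingType) (a k : F) :
  \tr (fam1_phi a *m fam1_psi a k) = 2 * a * k.
Proof. by rewrite !mx22E; ring. Qed.

Lemma det_fam1 (F : comNzRingType) (a k : F) :
  \det (1%:M - fam1_phi a - fam1_psi a k) = 1 - 2 * a * k - 2 * a ^+ 2.
Proof. by rewrite !mx22E; ring. Qed.

(** The exceptional value of k in the first family is the one for which
    1 - phi - psi is singular. *)
Lemma det_fam1_eq0 (F : fieldType) (a k : F) : (2 : F) != 0 -> a != 0 ->
  (\det (1%:M - fam1_phi a - fam1_psi a k) == 0) = (k == 2^-1 * a^-1 - a).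
Proof.
move=> two_neq0 a_neq0; rewrite det_fam1 -[RHS](inj_eq (mulfI two_neq0)).
rewrite -[RHS](inj_eq (mulfI a_neq0)) -[RHS]subr_eq0 -oppr_eq0; congr (_ == 0).
by field; rewrite two_neq0 a_neq0.
Qed.

Lemma det_psi_kl_eq0 (F : fieldType) (a k l : F) : l != 0 ->
  (\det (1%:M - comp_mx a 0 - psi_kl a k l) == 0) = conic a k l.
Proof.
move=> l_neq0; rewrite /conic -[LHS](inj_eq (mulfI l_neq0)) mulr0; congr (_ == 0).
by rewrite !mx22E; field.
Qed.

Lemma fam1_no_common_col (F : fieldType) (a k : F) : (2 : F) != 0 -> a != 0 ->
  k != a -> k != - a -> no_common_col (fam1_phi a) (fam1_psi a k).
Proof.
move=> two_neq0 a_neq0 ka kNa v x y /mulmx22_eigenvector[phi0 phi1] /mulmx22_eigenvector[psi0 psi1].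
rewrite mul0r addr0 in phi0; rewrite mul0r add0r in phi1.
have [v0|v0] := eqVneq (v 0 0) 0.
  by apply: cV2_eq0 => //; move: psi0; rewrite v0 !mulr0 add0r mul1r.
have [v1|v1] := eqVneq (v 1 0) 0.
  apply: cV2_eq0 => //; move: psi1; rewrite v1 !mulr0 addr0 => /eqP.
  rewrite mulf_eq0 subr_sqr mulf_eq0 subr_eq0 addr_eq0 eq_sym (negPf ka) /=.
  by rewrite eq_sym eqr_oppLR (negPf kNa) => /eqP.
have ax := mulIf v0 phi0; have := mulIf v1 phi1; rewrite -ax => /eqP.
by rewrite eq_sym -addr_eq0 -mulr2n -mulr_natl mulf_eq0 (negPf two_neq0) (negPf a_neq0).
Qed.

Lemma comp_mx_no_eigenvector (F : finFieldType) (a b : F) (psi : 'M[F]_2) :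
  irr_quad a b -> no_common_col (comp_mx a b) psi.
Proof.
move=> /irr_quadP no_root v x _ /mulmx22_eigenvector[e0 e1] _.
rewrite mul0r add0r mul1r in e0.
have v0 : v 0 0 = 0.
  apply/eqP; apply: contraT => v0_neq0; have /eqP := no_root x; case.
  apply: (mulIf v0_neq0); move: e1; rewrite e0 => e; rewrite mul0r.
  by apply/eqP; rewrite !mulrBl subr_eq0 subr_eq -(mulrA b) e expr2 mulrA.
by apply: cV2_eq0 => //; rewrite e0 v0 mulr0.
Qed.

Lemma irr_quad_sq (F : finFieldType) (a : F) : irr_quad a 0 = irr_sq a.
Proof. by rewrite irr_quadE irr_sqE; apply: eq_forallb => x; rewrite mul0r add0r. Qed.

Lemma irr_quad_neq0 (F : finFieldType) (a b : F) : irr_quad a b -> a != 0.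
Proof. by move/irr_quadP/(_ 0); rewrite expr0n mulr0 subr0 sub0r oppr_eq0. Qed.

Lemma unitmx_det (F : fieldType) (M : 'M[F]_2) : (M \in unitmx) = (\det M != 0).
Proof. by rewrite unitmxE unitfE. Qed.

(** A conjugation invariant which, on the members of the families, equals the
    position of the family in the list. *)
Definition family_index (F : finFieldType) (t : aff_data F) : nat :=
  let: (phi, psi, _) := t in
  (if psi == phi then 2 else if psi == (- phi)%R then 3 else
   (if irr_sq (- \det phi)%R then 4 else 0) +
   (\det (1%:M - phi - psi)%R == 0%R))%N.

(** Besides simplicity and paramediality, 1 - phi - psi must not vanish, so that
    membership of c in its image determines the isomorphism class over one pair. *)
Definition admissible_entry (p : nat) (t : aff_data 'F_p) : Prop :=
  let: (phi, psi, _) := t in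
  [/\ phi \in unitmx, psi \in unitmx, phi *m phi = psi *m psi,
      no_common_col phi psi & 1%:M - phi - psi != 0].

Lemma intertwines_invariants (F : finFieldType) (g phi psi phi' psi' : 'M[F]_2) :
  intertwines g phi psi phi' psi' ->
  [/\ \tr phi = \tr phi', \det phi = \det phi', \tr (phi *m psi) = \tr (phi' *m psi') &
      forall c c', family_index (phi, psi, c) = family_index (phi', psi', c')].
Proof.
case=> g_unit gphi gpsi.
have phi'E : phi' = g *m phi *m invmx g by rewrite gphi mulmxK.
have psi'E : psi' = g *m psi *m invmx g by rewrite gpsi mulmxK.
have trC M : \tr (g *m M *m invmx g) = \tr M.
  by rewrite mxtrace_mulC mulmxA mulVmx // mul1mx.
have detC M : \det (g *m M *m invmx g) = \det M.
  by rewrite !det_mulmx det_inv mulrAC mulrV ?mul1r // -unitmxE.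
have conjI : injective (fun M => g *m M *m invmx g).
  by move=> M N /(can_inj (mulmxKV g_unit))/(can_inj (mulKmx g_unit)).
have det1 : \det (1%:M - phi' - psi') = \det (1%:M - phi - psi).
  by rewrite -[RHS]detC !(mulmxBr, mulmxBl) mulmx1 mulmxV // phi'E psi'E.
split; rewrite ?phi'E ?psi'E ?trC ?detC //.
  by rewrite -[LHS]trC !mulmxA mulmxKV.
move=> c c'; rewrite /family_index -phi'E -psi'E det1.
have -> : (psi' == phi') = (psi == phi) by rewrite phi'E psi'E (inj_eq conjI).
have -> : (psi' == - phi') = (psi == - phi).
  by rewrite phi'E psi'E -mulNmx -mulmxN (inj_eq conjI).
by rewrite phi'E detC.
Qed.

Lemma fam1_params_lower_half (p : nat) (a k : 'F_p) :
  fam1_params a k = [&& a \in lower_half p, k != a & k != - a].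
Proof. by rewrite /fam1_params inE -andbA. Qed.

Lemma fam1_genericP (p : nat) (t : aff_data 'F_p) :
  reflect (exists a k, [/\ fam1_params a k, k != 2^-1 * a^-1 - a &
             t = (fam1_phi a, fam1_psi a k, col2 0 0)]) (t \in fam1_generic p).
Proof.
apply: (iffP imset2P) => [[a k _]|[a [k [ak k_gen ->]]]].
  by rewrite !inE /= => /andP[ak k_gen] ->; exists a, k.
by exists a k; rewrite ?inE //= ak.
Qed.

Lemma fam1_specialP (p : nat) (t : aff_data 'F_p) :
  reflect (exists a k c, [/\ fam1_params a k, k = 2^-1 * a^-1 - a,
             c \in [set col2 0 0; col2 0 1] & t = (fam1_phi a, fam1_psi a k, c)])
    (t \in fam1_special p).
Proof.
apply: (iffP imset2P) => [[[a k] c]|[a [k [c [ak k_spec c2 ->]]]]].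
  by rewrite inE /= => /andP[ak /eqP k_spec] c2 ->; exists a, k, c.
by exists (a, k) c; rewrite // inE /= ak k_spec eqxx.
Qed.

Lemma fam2P (F : finFieldType) (t : aff_data F) :
  reflect (exists a b, irr_quad a b /\ t = (comp_mx a b, comp_mx a b, col2 0 0))
    (t \in fam2 F).
Proof.
apply: (iffP imset2P) => [[a b _]|[a [b [ab ->]]]].
  by rewrite !inE /= => ab ->; exists a, b.
by exists a b; rewrite ?inE.
Qed.

Lemma fam3P (F : finFieldType) (t : aff_data F) :
  reflect (exists a b, irr_quad a b /\ t = (comp_mx a b, - comp_mx a b, col2 0 0))
    (t \in fam3 F).
Proof.
apply: (iffP imset2P) => [[a b _]|[a [b [ab ->]]]].
  by rewrite !inE /= => ab ->; exists a, b.
by exists a b; rewrite ?inE.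
Qed.

Lemma fam4P (F : finFieldType) (reps : F -> {set 'M[F]_2}) (t : aff_data F) :
  reflect (exists a psi, [/\ irr_sq a, psi \in reps a & t = (comp_mx a 0, psi, col2 0 0)])
    (t \in fam4 reps).
Proof.
apply: (iffP imset2P) => [[a psi]|[a [psi [a_nsq psi_rep ->]]]].
  by rewrite !inE /= => a_nsq psi_rep ->; exists a, psi.
by exists a psi; rewrite ?inE.
Qed.

Lemma fam5P (F : finFieldType) (kl : F -> F * F) (w : F -> 'cV[F]_2) (t : aff_data F) :
  reflect (exists a c, [/\ irr_sq a, c \in [set col2 0 0; w a] &
             t = (comp_mx a 0, psi_kl a (kl a).1 (kl a).2, c)])
    (t \in fam5 kl w).
Proof.
apply: (iffP imset2P) => [[a c]|[a [c [a_nsq cw ->]]]].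
  by rewrite inE => a_nsq cw ->; exists a, c.
by exists a c.
Qed.

Lemma trace_neq0_mx_neq0 (F : fieldType) (M : 'M[F]_2) : \tr M != 0 -> M != 0.
Proof. by apply: contra => /eqP ->; rewrite raddf0. Qed.

Lemma fam1_entry (p : nat) (a k : 'F_p) c : (2 : 'F_p) != 0 -> fam1_params a k ->
  admissible_entry (fam1_phi a, fam1_psi a k, c) /\
  family_index (fam1_phi a, fam1_psi a k, c) = (k == 2^-1 * a^-1 - a) :> nat.
Proof.
move=> two_neq0; rewrite fam1_params_lower_half => /and3P[/lower_half_neq0 a_neq0 ka kNa].
have aa_neq0 : - a ^+ 2 != 0 by rewrite oppr_eq0 expf_neq0.
have nsame (d : 'F_p) : fam1_psi a k != mx22 d 0 0 (- d).
  by apply/eqP=> /mx22_inj[_ /eqP]; rewrite oner_eq0.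
split; last first.
  rewrite /family_index det_fam1_eq0 // (negPf (nsame a)).
  have -> : - fam1_phi a = mx22 (- a) 0 0 (- - a) by rewrite opp_mx22 oppr0.
  rewrite (negPf (nsame (- a))) det_fam1_phi opprK.
  have /negPf -> : ~~ irr_sq (a ^+ 2) by apply/irr_sqP=> /(_ a); rewrite eqxx.
  by [].
split; rewrite ?unitmx_det ?det_fam1_phi ?det_fam1_psi //.
- by rewrite !sqr_traceless22 ?trace_fam1_phi ?trace_fam1_psi // det_fam1_phi det_fam1_psi.
- exact: fam1_no_common_col.
apply: trace_neq0_mx_neq0; rewrite !raddfB /= trace_fam1_phi trace_fam1_psi mxtrace_scalar.
by rewrite !subr0.
Qed.

Lemma mx22_01_neq0 (F : nzRingType) (M : 'M[F]_2) : M 0 1 != 0 -> M != 0.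
Proof. by apply: contra => /eqP ->; rewrite mxE. Qed.

Lemma fam2_entry (p : nat) (a b : 'F_p) c : (2 : 'F_p) != 0 -> irr_quad a b ->
  admissible_entry (comp_mx a b, comp_mx a b, c) /\
  family_index (comp_mx a b, comp_mx a b, c) = 2%N.
Proof.
move=> two_neq0 ab; have a_neq0 := irr_quad_neq0 ab.
split; last by rewrite /family_index eqxx.
split; rewrite ?unitmx_det ?det_comp_mx ?oppr_eq0 //; first exact: comp_mx_no_eigenvector.
apply: mx22_01_neq0; rewrite !mxE /=.
have -> : 0 - 1 - 1 = - 2 :> 'F_p by ring.
by rewrite oppr_eq0.
Qed.

Lemma opp_comp_mx_neq (F : fieldType) (a b : F) : (2 : F) != 0 ->
  - comp_mx a b != comp_mx a b.
Proof.
move=> two_neq0; apply/eqP=> /matrixP/(_ 0 1)/eqP; rewrite !mxE /=.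
by rewrite eq_sym -subr_eq0 opprK (negPf two_neq0).
Qed.

Lemma fam3_entry (p : nat) (a b : 'F_p) c : (2 : 'F_p) != 0 -> irr_quad a b ->
  admissible_entry (comp_mx a b, - comp_mx a b, c) /\
  family_index (comp_mx a b, - comp_mx a b, c) = 3%N.
Proof.
move=> two_neq0 ab; have a_neq0 := irr_quad_neq0 ab.
split; last by rewrite /family_index (negPf (opp_comp_mx_neq _ _ two_neq0)) eqxx.
have unit : comp_mx a b \in unitmx by rewrite unitmx_det det_comp_mx oppr_eq0.
split=> //.
- by rewrite -scaleN1r unitmxZ // unitrN1.
- by rewrite mulNmx mulmxN opprK.
- exact: comp_mx_no_eigenvector.
by rewrite opprK subrK; apply/eqP=> /matrixP/(_ 0 0)/eqP; rewrite !mxE oner_eq0.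
Qed.

(** Members of a level set other than the two excluded ones belong to family 4
    or, on the conic, to family 5, counting from 0. *)
Lemma level_entry (p : nat) (a t : 'F_p) M c : (2 : 'F_p) != 0 -> irr_sq a -> M \in level a t ->
  t != 2 * a -> t != - (2 * a) ->
  admissible_entry (comp_mx a 0, M, c) /\
  family_index (comp_mx a 0, M, c) = (4 + (t == 1 - 2 * a)%R)%N.
Proof.
move=> two_neq0 a_nsq M_lev t1 t2; have a_neq0 := irr_sq_neq0 a_nsq.
have [k [l [l_neq0 ME]]] := levelP a_nsq M_lev.
have := M_lev; rewrite inE => /and3P[/eqP trM /eqP detM /eqP tM].
have neqC : M != comp_mx a 0.
  apply: contra t1 => /eqP MC; rewrite -tM MC !mx22E; apply/eqP; ring.
have neqNC : M != - comp_mx a 0.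
  apply: contra t2 => /eqP MC; rewrite -tM MC !mx22E; apply/eqP; ring.
split; last first.
  rewrite /family_index (negPf neqC) (negPf neqNC) det_comp_mx opprK a_nsq.
  congr (4 + nat_of_bool _)%N; rewrite ME det_psi_kl_eq0 // conicE // -ME.
  by apply/idP/eqP => [/(level_inj M_lev)|<-].
split; rewrite ?unitmx_det ?det_comp_mx ?detM ?oppr_eq0 //.
- by rewrite !sqr_traceless22 ?trace_comp_mx // detM det_comp_mx.
- by apply: comp_mx_no_eigenvector; rewrite irr_quad_sq.
apply: trace_neq0_mx_neq0; rewrite !raddfB /= trace_comp_mx trM mxtrace_scalar.
by rewrite !subr0.
Qed.

Lemma reps_level (p : nat) (a : 'F_p) (X : {set 'M_2}) psi : prime p -> odd p ->
  irr_sq a -> orbit_representatives (fam4_orbits a) X -> psi \in X ->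
  exists t, [/\ psi \in level a t, t != 2 * a, t != - (2 * a) & t != 1 - 2 * a].
Proof.
move=> p_pr p_odd a_nsq [/subsetP sub _] /sub/bigcupP[O].
rewrite fam4_orbits_level // => /imsetP[t + ->] psiO.
by rewrite !inE !negb_or -andbA => /and3P[t1 t2 t3]; exists t.
Qed.

Lemma reps_in_level (p : nat) (a t : 'F_p) (X : {set 'M_2}) : prime p -> odd p ->
  irr_sq a -> orbit_representatives (fam4_orbits a) X ->
  t != 2 * a -> t != - (2 * a) -> t != 1 - 2 * a ->
  exists psi, X :&: level a t = [set psi].
Proof.
move=> p_pr p_odd a_nsq [_ one] t1 t2 t3; apply/cards1P/eqP/one.
rewrite fam4_orbits_level //; apply/imsetP; exists t => //.
by rewrite !inE !negb_or t1 t2.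
Qed.

Lemma families_entry (p : nat) reps kl w (i : 'I_6) (t : aff_data 'F_p) :
  prime p -> odd p -> valid_choices reps kl w ->
  t \in tnth (families reps kl w) i -> admissible_entry t /\ family_index t = i.
Proof.
move=> p_pr p_odd valid; have two_neq0 := Fp_two_neq0 p_pr p_odd.
case: i => [[|[|[|[|[|[|//]]]]]] lti]; rewrite /tnth /=.
- case/fam1_genericP=> a [k [ak k_gen ->]]; have := fam1_entry (col2 0 0) two_neq0 ak.
  by rewrite (negPf k_gen).
- case/fam1_specialP=> a [k [c [ak k_spec _ ->]]]; have := fam1_entry c two_neq0 ak.
  by rewrite k_spec eqxx.
- by case/fam2P=> a [b [ab ->]]; apply: fam2_entry.
- by case/fam3P=> a [b [ab ->]]; apply: fam3_entry.
- case/fam4P=> a [psi [a_nsq psi_rep ->]]; have [reps_ok _ _] := valid a a_nsq.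
  have [u [psi_lev u1 u2 u3]] := reps_level p_pr p_odd a_nsq reps_ok psi_rep.
  by have := level_entry (col2 0 0) two_neq0 a_nsq psi_lev u1 u2; rewrite (negPf u3).
case/fam5P=> a [c [a_nsq _ ->]]; have [_ conic_kl _] := valid a a_nsq.
have l_neq0 := conic_point_l_neq0 a_nsq (eqP conic_kl).
rewrite conicE // in conic_kl.
have [_ d2 d3] := excluded_levels_distinct two_neq0 a_nsq.
have := level_entry c two_neq0 a_nsq conic_kl; rewrite eqxx; apply; by rewrite eq_sym.
Qed.

(** * Exhaustiveness and absence of repetitions *)

Lemma mx_Im0 (F : finFieldType) (M : 'M[F]_2) : 0 \in mx_Im M.
Proof. by apply/imsetP; exists 0; rewrite ?mulmx0. Qed.

(** When 1 - phi - psi is singular, the second coordinate of (1 - phi - psi) v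
    vanishes together with the first. *)
Lemma fam1_special_notin_Im (F : finFieldType) (a k : F) : (2 : F) != 0 -> a != 0 ->
  k = 2^-1 * a^-1 - a -> col2 0 1 \notin mx_Im (1%:M - fam1_phi a - fam1_psi a k).
Proof.
move=> two_neq0 a_neq0 /eqP k_spec; apply/imsetP=> -[v _ vE].
move: k_spec; rewrite -det_fam1_eq0 // det_fam1 => /eqP det0.
move/colP: vE => vE; have := vE 0; have := vE 1.
rewrite !mx22E !mxE !big_ord_recl !big_ord0 !mxE /= !addr0.
have -> : lift ord0 ord0 = 1 :> 'I_2 by apply: val_inj.
move=> e1 e0.
have v1 : v 1 0 = (1 - a - k) * v 0 0.
  by apply/eqP; rewrite -subr_eq0 -oppr_eq0; apply/eqP; rewrite [RHS]e0; ring.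
move: e1; rewrite v1 => /eqP; apply/negP; rewrite -[X in _ == X]addr0.
have -> : (0 - 0 - (a ^+ 2 - k ^+ 2)) * v 0 0 + (1 - - a - - k) * ((1 - a - k) * v 0 0) =
  (1 - 2 * a * k - 2 * a ^+ 2) * v 0 0 by ring.
by rewrite det0 mul0r addr0 oner_eq0.
Qed.

(** Membership in the image separates the two admissible constants. *)
Lemma set2_by_mx_Im (F : finFieldType) (M : 'M[F]_2) (w c c' : 'cV[F]_2) :
  w \notin mx_Im M -> c \in [set col2 0 0; w] -> c' \in [set col2 0 0; w] ->
  (c \in mx_Im M) = (c' \in mx_Im M) -> c = c'.
Proof.
rewrite !inE col2_00 => /negPf wM /orP[] /eqP -> /orP[] /eqP -> //;
  by rewrite mx_Im0 wM.
Qed.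

(** Isomorphic members have conjugate pairs, so they lie in the same family by
    family_index. Inside a family det(phi) gives a, the trace of phi or of
    phi psi gives the remaining parameter, and membership of the constant in
    the image of 1 - phi - psi gives c. *)
Lemma families_unique (p : nat) reps kl w (i i' : 'I_6) (t t' : aff_data 'F_p) :
  prime p -> odd p -> valid_choices reps kl w ->
  t \in tnth (families reps kl w) i -> t' \in tnth (families reps kl w) i' ->
  qg_isomorphic (Aff_mx t) (Aff_mx t') -> (i, t) = (i', t').
Proof.
move=> p_pr p_odd valid ti ti' iso; have two_neq0 := Fp_two_neq0 p_pr p_odd.
have [spec idx] := families_entry p_pr p_odd valid ti.
have [_ idx'] := families_entry p_pr p_odd valid ti'.
move: t t' ti ti' iso spec idx idx' => [[phi psi] c] [[phi' psi'] c'].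
move=> ti ti' iso [phi_unit psi_unit _ _ _] idx idx'.
have [g intertw c_eq] := Aff_mx_isomorphic_intertwines phi_unit psi_unit iso.
have [tr_eq det_eq trM_eq idx_eq] := intertwines_invariants intertw.
have ii' : i = i' by apply: val_inj; rewrite /= -idx -idx' (idx_eq c c').
rewrite -{i'}ii' in ti' idx' *; congr pair.
move: c_eq tr_eq det_eq trM_eq {intertw idx idx' idx_eq iso phi_unit psi_unit}.
have fam1_inj (a k a' k' : 'F_p) : fam1_params a k -> fam1_params a' k' ->
    - a ^+ 2 = - a' ^+ 2 -> 2 * a * k = 2 * a' * k' -> a = a' /\ k = k'.
  rewrite !fam1_params_lower_half => /and3P[ah _ _] /and3P[ah' _ _].
  move=> /oppr_inj/(sqr_inj_lower_half ah ah') <- e; split=> //; apply: mulfI e.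
  by rewrite mulf_neq0 // (lower_half_neq0 ah).
case: i ti ti' => [[|[|[|[|[|[|//]]]]]] lti]; rewrite /tnth /=.
- move=> /fam1_genericP[a [k [ak _ [-> -> ->]]]] /fam1_genericP[a' [k' [ak' _ [-> -> ->]]]].
  rewrite !det_fam1_phi !trace_fam1_mul => _ _ ea ek.
  by have [-> ->] := fam1_inj _ _ _ _ ak ak' ea ek.
- move=> /fam1_specialP[a [k [d [ak k_spec d2 [-> -> ->]]]]].
  move=> /fam1_specialP[a' [k' [d' [ak' _ d'2 [-> -> ->]]]]].
  rewrite !det_fam1_phi !trace_fam1_mul => d_eq _ ea ek.
  have [aE kE] := fam1_inj _ _ _ _ ak ak' ea ek.
  rewrite -{a' ak' ea ek}aE -{k'}kE in d_eq *; congr pair.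
  apply: set2_by_mx_Im d2 d'2 d_eq; apply: fam1_special_notin_Im => //.
  by move: ak; rewrite fam1_params_lower_half => /and3P[/lower_half_neq0].
- move=> /fam2P[a [b [_ [-> -> ->]]]] /fam2P[a' [b' [_ [-> -> ->]]]] _.
  by rewrite !trace_comp_mx !det_comp_mx => -> /oppr_inj ->.
- move=> /fam3P[a [b [_ [-> -> ->]]]] /fam3P[a' [b' [_ [-> -> ->]]]] _.
  by rewrite !trace_comp_mx !det_comp_mx => -> /oppr_inj ->.
- move=> /fam4P[a [M [a_nsq M_rep [-> -> ->]]]] /fam4P[a' [M' [_ M'_rep [-> -> ->]]]] _ _.
  rewrite !det_comp_mx => /oppr_inj aE; rewrite -{a'}aE in M'_rep * => tM.
  have [reps_ok _ _] := valid a a_nsq.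
  have [u [M_lev u1 u2 u3]] := reps_level p_pr p_odd a_nsq reps_ok M_rep.
  have [u' [M'_lev _ _ _]] := reps_level p_pr p_odd a_nsq reps_ok M'_rep.
  have uu' : u = u'.
    by move: M_lev M'_lev; rewrite !inE => /and3P[_ _ /eqP <-] /and3P[_ _ /eqP <-].
  have [N NE] := reps_in_level p_pr p_odd a_nsq reps_ok u1 u2 u3.
  have : M \in [set N] by rewrite -NE inE M_rep.
  have : M' \in [set N] by rewrite -NE inE M'_rep uu'.
  by rewrite !inE => /eqP -> /eqP ->.
move=> /fam5P[a [d [a_nsq d2 [-> -> ->]]]] /fam5P[a' [d' [_ d'2 [-> -> ->]]]] d_eq _.
rewrite !det_comp_mx => /oppr_inj aE; rewrite -{a'}aE in d'2 d_eq * => _.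
have [_ _ wa] := valid a a_nsq.
by congr pair; apply: set2_by_mx_Im wa d2 d'2 d_eq.
Qed.

Lemma intertwines_isomorphic_set2 (F : finFieldType) (g phi psi phi' psi' : 'M[F]_2)
    (c w : 'cV[F]_2) :
  intertwines g phi psi phi' psi' -> 1%:M - phi' - psi' != 0 ->
  w \notin mx_Im (1%:M - phi' - psi') ->
  exists2 c', c' \in [set col2 0 0; w] &
    qg_isomorphic (Aff_mx (phi, psi, c)) (Aff_mx (phi', psi', c')).
Proof.
move=> intertw M_neq0 wM.
exists (if c \in mx_Im (1%:M - phi - psi) then col2 0 0 else w).
  by rewrite !inE; case: ifP; rewrite eqxx ?orbT.
apply: (intertwines_Aff_mx_isomorphic intertw) => //.
by case: ifP => _; rewrite ?col2_00 ?mx_Im0 // (negPf wM).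
Qed.

Lemma intertwines_isomorphic_unit (F : finFieldType) (g phi psi phi' psi' : 'M[F]_2)
    (c c' : 'cV[F]_2) :
  intertwines g phi psi phi' psi' -> 1%:M - phi' - psi' \in unitmx ->
  qg_isomorphic (Aff_mx (phi, psi, c)) (Aff_mx (phi', psi', c')).
Proof.
move=> intertw M_unit; apply: (intertwines_Aff_mx_isomorphic intertw).
  by apply: contraTneq M_unit => ->; rewrite unitmx_det det0 eqxx.
by rewrite -(mx_Im_intertwines c intertw) !mx_Im_unit.
Qed.

Lemma intertwines_level (F : finFieldType) (a : F) (phi psi M : 'M[F]_2) :
  irr_sq a -> \tr phi = 0 -> \tr psi = 0 -> \det phi = - a -> \det psi = - a ->
  M \in level a (\tr (phi *m psi)) -> exists g, intertwines g phi psi (comp_mx a 0) M.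
Proof.
move=> a_nsq trphi trpsi detphi detpsi M_lev.
have [k [l [l_neq0 ME]]] := levelP a_nsq M_lev; rewrite ME.
apply: intertwines_psi_kl => //; first exact: irr_sqP.
by move: M_lev; rewrite ME psi_kl_level // => /eqP.
Qed.

Lemma intertwines_inj (F : fieldType) (g phi psi phi' psi' : 'M[F]_2) :
  intertwines g phi psi phi' psi' ->
  (psi' = phi' -> psi = phi) /\ (psi' = - phi' -> psi = - phi).
Proof.
case=> g_unit gphi gpsi; split=> e; apply: (can_inj (mulKmx g_unit)).
  by rewrite gpsi e gphi.
by rewrite gpsi e mulNmx -gphi mulmxN.
Qed.

(** The cases psi = phi, psi = - phi, and the trace-zero pairs according to
    whether - det(phi) is a square and 1 - phi - psi is singular. *)
Lemma families_exhaustive (p : nat) reps kl w (phi psi : 'M['F_p]_2) (c : 'cV['F_p]_2) :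
  prime p -> odd p -> valid_choices reps kl w ->
  phi \in unitmx -> phi *m phi = psi *m psi -> no_common_row phi psi ->
  exists (i : 'I_6) (t : aff_data 'F_p), t \in tnth (families reps kl w) i /\
    qg_isomorphic (Aff_mx (phi, psi, c)) (Aff_mx t).
Proof.
move=> p_pr p_odd valid phi_unit sq_eq irr; have two_neq0 := Fp_two_neq0 p_pr p_odd.
have no_root eps : psi = eps *: phi -> forall x, x ^+ 2 - \tr phi * x + \det phi != 0.
  move=> psiE x; apply/eqP=> /exists_left_eigenvector[r /eqP r_neq0 r_phi]; apply: r_neq0.
  by apply: (irr _ x (eps * x) r_phi); rewrite psiE -scalemxAr r_phi scalerA.
have irr_quad_char eps : psi = eps *: phi -> irr_quad (- \det phi) (\tr phi).
  by move=> e; apply/irr_quadP=> x; rewrite opprK (no_root eps).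
have [psiE|psi_neq] := eqVneq psi phi.
  have psiE1 : psi = 1 *: phi by rewrite scale1r.
  have [g g_unit gphi] := intertwines_comp_mx (no_root _ psiE1).
  have ab := irr_quad_char _ psiE1.
  exists (Ordinal (isT : 2 < 6)%N),
    (comp_mx (- \det phi) (\tr phi), comp_mx (- \det phi) (\tr phi), col2 0 0).
  split; first by rewrite /tnth /=; apply/fam2P; do 2!eexists; split; first exact: ab.
  apply: (@intertwines_isomorphic_unit _ g); first by rewrite psiE.
  rewrite unitmx_det; move: ab; set a := - _; set b := \tr phi => /irr_quadP/(_ 2^-1).
  apply: contra => /eqP; rewrite !mx22E => e.
  rewrite -(inj_eq (mulfI two_neq0)) -(inj_eq (mulfI two_neq0)) !mulr0 -e.
  by apply/eqP; field.
have [psiE|psi_neqN] := eqVneq psi (- phi).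
  have psiEN : psi = (- 1) *: phi by rewrite scaleN1r.
  have [g g_unit gphi] := intertwines_comp_mx (no_root _ psiEN).
  have ab := irr_quad_char _ psiEN.
  exists (Ordinal (isT : 3 < 6)%N),
    (comp_mx (- \det phi) (\tr phi), - comp_mx (- \det phi) (\tr phi), col2 0 0).
  split; first by rewrite /tnth /=; apply/fam3P; do 2!eexists; split; first exact: ab.
  apply: (@intertwines_isomorphic_unit _ g).
    by rewrite psiE; split; rewrite // mulmxN gphi mulNmx.
  by rewrite opprK subrK unitmx1.
have [trphi trpsi det_eq] := same_square_cases sq_eq irr psi_neq psi_neqN.
have detphi_neq0 : \det phi != 0 by rewrite -unitmx_det.
have [a_nsq|] := boolP (irr_sq (- \det phi)); last first.
  rewrite irr_sqE => /forallPn[s0]; rewrite negbK => /eqP s0E.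
  have [s sh sE] : exists2 s, s \in lower_half p & s ^+ 2 = - \det phi.
    have s0_neq0 : s0 != 0.
      by apply: contra detphi_neq0 => /eqP s0_0; rewrite -oppr_eq0 -s0E s0_0 expr0n.
    have /orP[sh|sh] := lower_half_cases p_pr p_odd s0_neq0; first by exists s0.
    by exists (- s0); rewrite ?sqrrN.
  have s_neq0 := lower_half_neq0 sh.
  have detphi : \det phi = - s ^+ 2 by rewrite sE opprK.
  have detpsi : \det psi = - s ^+ 2 by rewrite -det_eq.
  have [k [ks kNs [g intertw]]] :=
    intertwines_fam1 two_neq0 s_neq0 trphi trpsi detphi detpsi irr.
  have sk : fam1_params s k by rewrite fam1_params_lower_half sh ks.
  have [[_ _ _ _ M_neq0] _] := fam1_entry 0 two_neq0 sk.
  have [k_spec|k_gen] := eqVneq k (2^-1 * s^-1 - s).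
    have [c' c'2 iso] := intertwines_isomorphic_set2 c intertw M_neq0
      (fam1_special_notin_Im two_neq0 s_neq0 k_spec).
    exists (Ordinal (isT : 1 < 6)%N); eexists; split; last exact: iso.
    by rewrite /tnth /=; apply/fam1_specialP; exists s, k, c'.
  exists (Ordinal (isT : 0 < 6)%N), (fam1_phi s, fam1_psi s k, col2 0 0); split.
    by rewrite /tnth /=; apply/fam1_genericP; exists s, k.
  by apply: (intertwines_isomorphic_unit _ _ intertw); rewrite unitmx_det det_fam1_eq0.
set a := - \det phi in a_nsq.
have detphi : \det phi = - a by rewrite opprK.
have detpsi : \det psi = - a by rewrite -det_eq.
set t := \tr (phi *m psi).
have conj_level M : M \in level a t -> exists g, intertwines g phi psi (comp_mx a 0) M.
  exact: intertwines_level.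
have [k [l [l_neq0 lev]]] := level_nonempty t p_pr p_odd a_nsq.
have [g0 intertw0] := conj_level _ lev; have [inj_same inj_opp] := intertwines_inj intertw0.
have t1 : t != 2 * a.
  apply: contra psi_neq => /eqP tE; rewrite tE level_same // in lev.
  by move/eqP: lev inj_same => [-> ->]; rewrite psi_kl_same => ->.
have t2 : t != - (2 * a).
  apply: contra psi_neqN => /eqP tE; rewrite tE level_opposite // in lev.
  by move/eqP: lev inj_opp => [-> ->]; rewrite psi_kl_opposite => ->.
(* The conic corresponds to t = 1 - 2 a: there the chosen point gives the matrix. *)
have [reps_ok conic_kl wa] := valid a a_nsq.
have [t3|t3] := eqVneq t (1 - 2 * a).
  have kl_neq0 := conic_point_l_neq0 a_nsq (eqP conic_kl).
  rewrite conicE // -t3 in conic_kl.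
  have [g intertw] := conj_level _ conic_kl.
  have [[_ _ _ _ M_neq0] _] := level_entry 0 two_neq0 a_nsq conic_kl t1 t2.
  have [c' c'2 iso] := intertwines_isomorphic_set2 c intertw M_neq0 wa.
  exists (Ordinal (isT : 5 < 6)%N); eexists; split; last exact: iso.
  by rewrite /tnth /=; apply/fam5P; exists a, c'.
have [M ME] := reps_in_level p_pr p_odd a_nsq reps_ok t1 t2 t3.
have /setIP[M_rep M_lev] : M \in reps a :&: level a t by rewrite ME set11.
have [g intertw] := conj_level _ M_lev.
exists (Ordinal (isT : 4 < 6)%N), (comp_mx a 0, M, col2 0 0); split.
  by rewrite /tnth /=; apply/fam4P; exists a, M.
apply: (intertwines_isomorphic_unit _ _ intertw); rewrite unitmx_det.
have [k' [l' [l'_neq0 M_kl]]] := levelP a_nsq M_lev.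
rewrite M_kl det_psi_kl_eq0 // conicE // -M_kl.
by apply: contra t3 => M_lev'; apply/eqP/(level_inj M_lev M_lev').
Qed.

(** * Cardinalities of the families *)

Lemma card_uniform_fibers (T1 T2 : finType) (D : {set T1}) (S : {set T1 * T2}) n :
  (forall a b, (a, b) \in S -> a \in D) ->
  (forall a, a \in D -> #|[set b | (a, b) \in S]| = n) -> #|S| = (#|D| * n)%N.
Proof.
move=> S_D fib; rewrite -sum1_card.
have -> : (\sum_(ab in S) 1 = \sum_(a in D) \sum_(b | (a, b) \in S) 1)%N.
  rewrite pair_big_dep; apply: eq_bigl => -[a b] /=.
  by case: (boolP ((a, b) \in S)) => [/S_D ->|]; rewrite ?andbF.
rewrite -sum_nat_const; apply: eq_bigr => a /fib <-; rewrite -sum1_card.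
by apply: eq_bigl => b; rewrite inE.
Qed.

Lemma card_injective_image (T U : finType) (f : T -> U) (S : {set T}) (X : {set U}) :
  injective f -> (forall u, reflect (exists2 x, x \in S & u = f x) (u \in X)) ->
  #|X| = #|S|.
Proof.
move=> f_inj XP; rewrite -(card_imset (mem S) f_inj); apply: eq_card => u.
by apply/XP/imsetP.
Qed.

(** The a for which the exceptional k = 1 / (2 a) - a is an admissible
    parameter of the first family. *)
Definition special_lower_half (p : nat) : {set 'F_p} :=
  [set a in lower_half p | 2^-1 * a^-1 - a != a].

Lemma special_k_neqN (p : nat) (a : 'F_p) : (2 : 'F_p) != 0 -> a != 0 ->
  2^-1 * a^-1 - a != - a.
Proof.
by move=> two_neq0 a_neq0; rewrite -subr_eq0 opprK subrK mulf_neq0 ?invr_eq0.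
Qed.

(** The excluded residues are the square roots of 1/4, exactly one of which
    lies in the lower half. *)
Lemma card_special_lower_half (p : nat) : prime p -> odd p ->
  #|lower_half p| = #|special_lower_half p|.+1.
Proof.
move=> p_pr p_odd; have two_neq0 := Fp_two_neq0 p_pr p_odd.
have four_neq0 : (4 : 'F_p) != 0 by rewrite (natrM _ 2 2) mulf_neq0.
have inv2_neq0 : (2^-1 : 'F_p) != 0 by rewrite invr_eq0.
have special_eq (a : 'F_p) : a != 0 -> (2^-1 * a^-1 - a == a) = (a ^+ 2 == 2^-1 ^+ 2).
  move=> a_neq0; rewrite -[LHS]subr_eq0 -[RHS]subr_eq0.
  rewrite -[RHS]oppr_eq0 -[LHS](inj_eq (mulfI a_neq0)) -[RHS](inj_eq (mulfI two_neq0)).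
  by rewrite !mulr0; congr (_ == 0); field; rewrite ?two_neq0 ?a_neq0.
have [h hh hE] : exists2 h, h \in lower_half p & h ^+ 2 = 2^-1 ^+ 2.
  have /orP[] := lower_half_cases p_pr p_odd inv2_neq0; first by exists 2^-1.
  by exists (- 2^-1); rewrite ?sqrrN.
rewrite (cardsD1 h) hh add1n; congr _.+1; apply: eq_card => a; rewrite !inE -/(lower_half p).
rewrite andbC; case: (boolP (a \in lower_half p)) => ah; move: (ah); rewrite inE => aE.
  rewrite aE /= special_eq ?(lower_half_neq0 ah) // -hE.
  by apply/idP/idP; apply: contra => /eqP; [move/(sqr_inj_lower_half ah hh) => ->|move=> ->].
by rewrite (negPf aE).
Qed.

Lemma card_fam1_special (p : nat) : prime p -> odd p -> #|fam1_special p| = (p - 3)%N.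
Proof.
move=> p_pr p_odd; have two_neq0 := Fp_two_neq0 p_pr p_odd.
pose f (ac : 'F_p * 'cV['F_p]_2) : aff_data 'F_p :=
  (fam1_phi ac.1, fam1_psi ac.1 (2^-1 * ac.1^-1 - ac.1), ac.2).
rewrite (@card_injective_image _ _ f (setX (special_lower_half p) [set col2 0 0; col2 0 1])).
- rewrite cardsX cards2.
  have -> : col2 0 0 != col2 0 1 :> 'cV['F_p]_2.
    by apply/eqP=> /colP/(_ 1)/esym/eqP; rewrite !mxE oner_eq0.
  have := card_lower_half p_pr p_odd; rewrite card_special_lower_half //.
  by move: #|special_lower_half p| => h; have := prime_gt0 p_pr; rewrite /=; lia.
- by move=> [a c] [a' c']; rewrite /f /= => -[/mx22_inj[-> _ _ _] _ ->].
move=> t; apply: (iffP (fam1_specialP t)).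
  move=> [a [k [c [ak kE c2 ->]]]]; rewrite {k}kE in ak *.
  exists (a, c) => //; rewrite in_setX c2 andbT.
  by move: ak; rewrite fam1_params_lower_half => /and3P[ah ka _]; apply/setIdP.
move=> [[a c]]; rewrite in_setX => /andP[/setIdP[ah ka] c2] ->.
exists a, (2^-1 * a^-1 - a), c; split=> //; rewrite fam1_params_lower_half ah ka.
by rewrite special_k_neqN // (lower_half_neq0 ah).
Qed.

Lemma card_fam1_generic (p : nat) : prime p -> odd p ->
  #|fam1_generic p| = ((p ^ 2 + 5 - 4 * p) %/ 2)%N.
Proof.
move=> p_pr p_odd; have two_neq0 := Fp_two_neq0 p_pr p_odd.
pose f (ak : 'F_p * 'F_p) : aff_data 'F_p := (fam1_phi ak.1, fam1_psi ak.1 ak.2, col2 0 0).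
pose S := [set ak : 'F_p * 'F_p | fam1_params ak.1 ak.2].
pose Q := [set ak : 'F_p * 'F_p | ak.2 == 2^-1 * ak.1^-1 - ak.1].
rewrite (@card_injective_image _ _ f (S :\: Q)); first last.
- move=> t; apply: (iffP (fam1_genericP t)).
    by move=> [a [k [ak k_gen ->]]]; exists (a, k); rewrite // !inE k_gen.
  by move=> [[a k]]; rewrite !inE /= => /andP[k_gen ak] ->; exists a, k.
- by move=> [a k] [a' k'] [/mx22_inj[-> _ _ _] /mx22_inj[-> _ _ _]].
have cardS : #|S| = (#|lower_half p| * (p - 2))%N.
  apply: card_uniform_fibers => [a k|a ah].
    by rewrite inE /= fam1_params_lower_half => /and3P[].
  have -> : [set k | (a, k) \in S] = ~: [set a; - a].
    by apply/setP=> k; rewrite !inE /= fam1_params_lower_half ah negb_or.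
  have aNa : a != - a by apply: contraTneq (lower_halfN ah) => <-; rewrite ah.
  have := cardsC [set a; - a]; rewrite cards2 aNa card_Fp // => e.
  by rewrite -[X in (X - _)%N]e addKn.
have cardQ : #|S :&: Q| = #|special_lower_half p|.
  have inj : injective (fun a : 'F_p => (a, 2^-1 * a^-1 - a)) by move=> a b [].
  rewrite -(card_imset (mem (special_lower_half p)) inj); apply: eq_card => -[a k].
  apply/setIP/imsetP => [[]|[b bh [-> ->]]].
    rewrite !inE /= fam1_params_lower_half => /and3P[ah ka _] /eqP kE.
    by exists a; rewrite -?kE //; apply/setIdP; rewrite -kE.
  have /setIdP[bh' kb] := bh; rewrite !inE /= fam1_params_lower_half bh' kb eqxx.
  by rewrite special_k_neqN // (lower_half_neq0 bh').
have := cardsID Q S; rewrite cardS cardQ card_special_lower_half //.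
have := card_lower_half p_pr p_odd; rewrite card_special_lower_half //.
move: #|special_lower_half p| #|S :\: Q| => h N pE NE.
have {}pE : p = (2 * h + 3)%N by have := prime_gt0 p_pr; lia.
by move: NE; rewrite pE; nia.
Qed.

(** The map (a, b) |-> (b^2 + 4 a, b) is a bijection, and irreducibility means
    that the first coordinate is not a square. *)
Lemma card_irr_quad (p : nat) : prime p -> odd p ->
  #|[set ab : 'F_p * 'F_p | irr_quad ab.1 ab.2]| = ((p ^ 2 - p) %/ 2)%N.
Proof.
move=> p_pr p_odd; have two_neq0 := Fp_two_neq0 p_pr p_odd.
have four_neq0 : (4 : 'F_p) != 0 by rewrite (natrM _ 2 2) mulf_neq0.
pose f (db : 'F_p * 'F_p) := ((db.1 - db.2 ^+ 2) / 4, db.2).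
have f_inj : injective f.
  have inv4_neq0 : (4^-1 : 'F_p) != 0 by rewrite invr_eq0.
  move=> [d b] [d' b'] e; have /= bE := congr1 snd e; have /= := congr1 fst e.
  by rewrite -bE => /(mulIf inv4_neq0)/addIr ->.
rewrite (@card_injective_image _ _ f (setX [set d : 'F_p | irr_sq d] setT) _ f_inj).
  rewrite cardsX cardsT card_irr_sq // card_Fp //.
  have := card_lower_half p_pr p_odd; move: #|lower_half p| => h hE.
  have -> : p = (2 * h + 1)%N by have := prime_gt0 p_pr; lia.
  by nia.
move=> [a b]; rewrite inE /= irr_quad_discriminant //; apply: (iffP idP) => [nsq|].
  exists (b ^+ 2 + 4 * a, b); first by rewrite !inE nsq.
  by rewrite /f /=; congr pair; field.
move=> [[d b']]; rewrite !inE andbT /= => nsq [-> ->].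
have -> : b' ^+ 2 + 4 * ((d - b' ^+ 2) / 4) = d by field.
by [].
Qed.

Lemma card_fam2 (p : nat) : prime p -> odd p -> #|fam2 'F_p| = ((p ^ 2 - p) %/ 2)%N.
Proof.
move=> p_pr p_odd; rewrite -card_irr_quad //.
apply: (@card_injective_image _ _
  (fun ab => (comp_mx ab.1 ab.2, comp_mx ab.1 ab.2, col2 0 0) : aff_data 'F_p)).
  by move=> [a b] [a' b'] [/mx22_inj[_ _ -> ->]].
move=> t; apply: (iffP (fam2P t)) => [[a [b [ab ->]]]|[[a b] + ->]].
  by exists (a, b); rewrite ?inE.
by rewrite inE /= => ab; exists a, b.
Qed.

Lemma card_fam3 (p : nat) : prime p -> odd p -> #|fam3 'F_p| = ((p ^ 2 - p) %/ 2)%N.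
Proof.
move=> p_pr p_odd; rewrite -card_irr_quad //.
apply: (@card_injective_image _ _
  (fun ab => (comp_mx ab.1 ab.2, - comp_mx ab.1 ab.2, col2 0 0) : aff_data 'F_p)).
  by move=> [a b] [a' b'] [/mx22_inj[_ _ -> ->]].
move=> t; apply: (iffP (fam3P t)) => [[a [b [ab ->]]]|[[a b] + ->]].
  by exists (a, b); rewrite ?inE.
by rewrite inE /= => ab; exists a, b.
Qed.

Lemma card_fam4 (p : nat) (reps : 'F_p -> {set 'M['F_p]_2}) : prime p -> odd p ->
  (forall a, irr_sq a -> orbit_representatives (fam4_orbits a) (reps a)) ->
  #|fam4 reps| = ((p - 1) * (p - 3) %/ 2)%N.
Proof.
move=> p_pr p_odd reps_ok.
pose S := [set ac : 'F_p * 'M['F_p]_2 | irr_sq ac.1 && (ac.2 \in reps ac.1)].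
rewrite (@card_injective_image _ _
  (fun ac => (comp_mx ac.1 0, ac.2, col2 0 0) : aff_data 'F_p) S).
- have -> : #|S| = (#|[set a : 'F_p | irr_sq a]| * (p - 3))%N.
    apply: card_uniform_fibers => [a M|a]; rewrite !inE /=; first by case/andP.
    move=> a_nsq; rewrite -(card_fam4_orbits p_pr p_odd a_nsq).
    have /(orbit_representatives_transversal (reps a)
      (fam4_orbits_trivIset p_pr p_odd a_nsq)) := fam4_orbits_no_set0 p_pr p_odd a_nsq.
    case=> /(_ (reps_ok a a_nsq))/card_transversal <- _.
    by apply: eq_card => M; rewrite !inE /= a_nsq.
  rewrite card_irr_sq //; have := card_lower_half p_pr p_odd; move: #|lower_half p| => h hE.
  have -> : p = (2 * h + 1)%N by have := prime_gt0 p_pr; lia.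
  by nia.
- by move=> [a M] [a' M'] [/mx22_inj[_ _ -> _] ->].
move=> t; apply: (iffP (fam4P reps t)) => [[a [M [a_nsq M_rep ->]]]|[[a M] + ->]].
  by exists (a, M); rewrite // inE a_nsq.
by rewrite inE /= => /andP[a_nsq M_rep]; exists a, M.
Qed.

Lemma card_fam5 (p : nat) (kl : 'F_p -> 'F_p * 'F_p) (w : 'F_p -> 'cV['F_p]_2) :
  prime p -> odd p -> (forall a, irr_sq a -> w a != 0) ->
  #|fam5 kl w| = (p - 1)%N.
Proof.
move=> p_pr p_odd w_neq0.
pose S := [set ac : 'F_p * 'cV['F_p]_2 | irr_sq ac.1 && (ac.2 \in [set col2 0 0; w ac.1])].
rewrite (@card_injective_image _ _ (fun ac =>
  (comp_mx ac.1 0, psi_kl ac.1 (kl ac.1).1 (kl ac.1).2, ac.2) : aff_data 'F_p) S).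
- have -> : #|S| = (#|[set a : 'F_p | irr_sq a]| * 2)%N.
    apply: card_uniform_fibers => [a c|a]; rewrite !inE /=; first by case/andP.
    move=> a_nsq.
    have -> : [set c | (a, c) \in S] = [set col2 0 0; w a].
      by apply/setP=> c; rewrite !inE /= a_nsq.
    by rewrite cards2 col2_00 eq_sym w_neq0.
  rewrite card_irr_sq // muln2 card_lower_half // subn1 //.
- by move=> [a c] [a' c'] [/mx22_inj[_ _ -> _] _ ->].
move=> t; apply: (iffP (fam5P kl w t)) => [[a [c [a_nsq cw ->]]]|[[a c] + ->]].
  by exists (a, c); rewrite // inE a_nsq.
by rewrite inE /= => /andP[a_nsq cw]; exists a, c.
Qed.

(** * The classification *)

Lemma families_simple_paramedial (p : nat) (reps : 'F_p -> {set 'M['F_p]_2})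
    (kl : 'F_p -> 'F_p * 'F_p) (w : 'F_p -> 'cV['F_p]_2) (i : 'I_6) (t : aff_data 'F_p) :
  prime p -> odd p -> valid_choices reps kl w -> t \in tnth (families reps kl w) i ->
  simple_paramedial_quasigroup_of_order (p ^ 2) (Aff_mx t).
Proof.
move=> p_pr p_odd valid /(families_entry p_pr p_odd valid)[].
by case: t => [[phi psi] c] [? ? ? ? _] _; apply: Aff_mx_simple_paramedial.
Qed.

Lemma simple_paramedial_classified (p : nat) (reps : 'F_p -> {set 'M['F_p]_2})
    (kl : 'F_p -> 'F_p * 'F_p) (w : 'F_p -> 'cV['F_p]_2) (A : finType) (op : A -> A -> A) :
  prime p -> odd p -> valid_choices reps kl w ->
  simple_paramedial_quasigroup_of_order (p ^ 2) op ->
  exists (i : 'I_6) (t : aff_data 'F_p),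
    t \in tnth (families reps kl w) i /\ qg_isomorphic op (Aff_mx t).
Proof.
move=> p_pr p_odd valid spq; have [qg pm simpl _] := spq.
have [phi [psi [c iso]]] := simple_paramedial_coordinates p_pr spq.
have [phi_unit _] := quasigroup_Aff_mx_unit (quasigroup_isomorphic iso qg).
have sq_eq := (paramedial_Aff_mx _ _ _).1 (paramedial_isomorphic iso pm).
have irr := simple_Aff_mx_no_common_row (simple_isomorphic iso simpl).
have [i [t [ti iso']]] := families_exhaustive c p_pr p_odd valid phi_unit sq_eq irr.
by exists i, t; split=> //; apply: qg_isomorphic_trans iso iso'.
Qed.

(** On the conic 1 - phi - psi is singular, so a nonzero linear form vanishes
    on its image. *)
Lemma conic_Im_proper (F : finFieldType) (a k l : F) : irr_sq a -> conic a k l ->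
  exists w, w \notin mx_Im (1%:M - comp_mx a 0 - psi_kl a k l).
Proof.
move=> a_nsq kl; have l_neq0 := conic_point_l_neq0 a_nsq (eqP kl).
rewrite -det_psi_kl_eq0 // in kl.
set M := 1%:M - _ - _ in kl *.
have [r r_neq0 rM] := det0P kl.
have [j rj_neq0] : exists j, r 0 j != 0.
  apply/existsP; apply: contraR r_neq0 => /existsPn r0.
  by apply/eqP/rowP=> j; rewrite mxE; apply/eqP/negbNE.
exists (delta_mx j 0); apply/imsetP=> -[v _ vE].
have /colP/(_ 0) : r *m delta_mx j 0 = 0 :> 'M_1 by rewrite vE mulmxA rM mul0mx.
by rewrite -colE !mxE; apply/eqP.
Qed.

Theorem mainTheorem3 (p : nat) (p_prime : prime p) (p_odd : odd p) :
  (forall a : 'F_p, irr_sq a ->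
     [/\ #|fam4_orbits a| = (p - 3)%N,
         exists reps, orbit_representatives (fam4_orbits a) reps,
         exists k l, conic a k l,
         forall k l, conic a k l -> l != 0 &
         forall k l, conic a k l ->
           exists w, w \notin mx_Im (1%:M - comp_mx a 0 - psi_kl a k l)])
  /\
  (forall (reps : 'F_p -> {set 'M['F_p]_2}) (kl : 'F_p -> 'F_p * 'F_p)
          (w : 'F_p -> 'cV['F_p]_2),
     valid_choices reps kl w ->
     [/\ forall (i : 'I_6) (t : aff_data 'F_p),
           t \in tnth (families reps kl w) i ->
           simple_paramedial_quasigroup_of_order (p ^ 2) (Aff_mx t),
         forall (A : finType) (op : A -> A -> A),
           simple_paramedial_quasigroup_of_order (p ^ 2) op ->
           exists! it : 'I_6 * aff_data 'F_p,
             it.2 \in tnth (families reps kl w) it.1 /\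
             qg_isomorphic op (Aff_mx it.2) &
         [/\ #|fam1_generic p| = ((p ^ 2 + 5 - 4 * p) %/ 2)%N,
             #|fam1_special p| = (p - 3)%N,
             #|fam2 'F_p| = ((p ^ 2 - p) %/ 2)%N /\
             #|fam3 'F_p| = ((p ^ 2 - p) %/ 2)%N,
             #|fam4 reps| = ((p - 1) * (p - 3) %/ 2)%N &
             #|fam5 kl w| = (p - 1)%N]]).
Proof.
split=> [a a_nsq|reps kl w valid].
  split; first exact: card_fam4_orbits.
  - have tI := fam4_orbits_trivIset p_prime p_odd a_nsq.
    have n0 := fam4_orbits_no_set0 p_prime p_odd a_nsq.
    have part : partition (fam4_orbits a) (cover (fam4_orbits a)) by apply/and3P.
    exists (transversal (fam4_orbits a) (cover (fam4_orbits a))).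
    exact/(orbit_representatives_transversal _ tI n0)/transversalP.
  - have [k [l kl]] := exists_conic_point (1 - 2 * a) p_prime p_odd (irr_sq_neq0 a_nsq).
    by exists k, l; apply/eqP.
  - by move=> k l /eqP; apply: conic_point_l_neq0.
  by move=> k l; apply: conic_Im_proper.
split.
- by move=> i t; apply: families_simple_paramedial.
- move=> A op spq.
  have [i [t [ti iso]]] := simple_paramedial_classified p_prime p_odd valid spq.
  exists (i, t); split=> // -[i' t'] /= [ti' iso'].
  apply: (families_unique p_prime p_odd valid ti ti').
  exact: qg_isomorphic_trans (qg_isomorphic_sym iso) iso'.
split.
- exact: card_fam1_generic.
- exact: card_fam1_special.
- by split; [apply: card_fam2|apply: card_fam3].
- by apply: card_fam4 => // a /valid[].
apply: card_fam5 => // a /valid[_ _ wa].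
by apply: contraNneq wa => ->; apply: mx_Im0.
Qed.
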